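(* Let $(\mathcal{M},\varphi,\xi,\eta,g)$ be a 5-dimensional elliptic ($\sigma=1$) or hyperbolic ($\sigma=-1$) weakly para-cosymplectic manifold with para-K\''ahler leaves, $(V_0=\xi,V_1,V_2,V_3,V_4)$ an arbitrary adopted local frame, $(\theta^0=\eta,\theta^1,\ldots,\theta^4)$ its metric-dual coframe, $\tau_1,\tau_2,\omega$ the associated 1-forms, $\varTheta^{ij}=2\theta^i\wedge\theta^j$ and $D\omega=d\omega-\omega\wedge(\tau_1+\tau_2)$. Then there are local functions $\alpha_1,\alpha_2,\beta_1,\beta_2,\gamma$ such that $$d\tau_1=\alpha_1\theta^1\wedge\theta^2+\alpha_2\theta^1\wedge\theta^3,\qquad d\tau_2=\beta_1\theta^1\wedge\theta^2+\beta_2\theta^2\wedge\theta^4,$$ $$D\omega=\gamma\,\theta^1\wedge\theta^2-\alpha_1\theta^1\wedge\theta^3-\beta_1\theta^2\wedge\theta^4,$$ and the Riemann-Christoffel curvature $R$, the Ricci tensor $Ric$ and the scalar curvature $r$ have the decompositions $$R=(\sigma+2\gamma)\,\varTheta^{12}\cdot\varTheta^{12}-\alpha_2\,\varTheta^{13}\cdot\varTheta^{13}-\beta_2\,\varTheta^{24}\cdot\varTheta^{24}-2\left(\alpha_1\,\varTheta^{12}\cdot\varTheta^{13}+\beta_1\,\varTheta^{12}\cdot\varTheta^{24}\right),$$ $$Ric=Tr_g(R)=-2\alpha_2\theta^1\odot\theta^3-2\beta_2\theta^2\odot\theta^4-2(\alpha_1-\beta_1)\theta^1\odot\theta^2,\qquad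 r=-2(\alpha_2+\beta_2).$$ The functions $\alpha_2$, $\beta_2$ are eigen-functions, each of multiplicity $2$, of the Ricci tensor; thus they are independent of the particular choice of an adopted frame.
   Context: All manifolds, tensor fields and functions are smooth. An almost para-contact metric structure on $\mathcal{M}$, $\dim\mathcal{M}=2n+1$, is a quadruple $(\varphi,\xi,\eta,g)$ ($\varphi$ a $(1,1)$-tensor field, $\xi$ a vector field, $\eta$ a 1-form, $g$ a pseudo-Riemannian metric) with $\varphi^2=Id-\eta\otimes\xi$, $\eta(\xi)=1$, $g(\varphi X,\varphi Y)=-g(X,Y)+\eta(X)\eta(Y)$, $\eta(X)=g(\xi,X)$. With $\varPhi(X,Y)=g(\varphi X,Y)$, the manifold is almost para-cosymplectic if $d\eta=0$ and $d\varPhi=0$; it is then weakly para-cosymplectic if $R(X,Y)\varphi Z=\varphi R(X,Y)Z$ for all $X,Y,Z$, where $R(X,Y)Z=\nabla_X\nabla_YZ-\nabla_Y\nabla_XZ-\nabla_{[X,Y]}Z$ and $\nabla$ is the Levi-Civita connection. $R(X,Y,Z,W)=g(R(X,Y)Z,W)$, $Ric(X,Y)=\mathrm{Tr}\{Z\mapsto R(Z,X)Y\}$, $r=\mathrm{Tr}_gRic$. Put $AX=-\nabla_X\xi$. Each leaf of the foliation $\eta=0$ inherits an almost para-Hermitian structure $(P,H)$ by restricting $\varphi$ and $g$; the manifold has para-K\''ahler leaves if $P$ is parallel for the Levi-Civita connection of $H$ on every leaf, equivalently $(\nabla_X\varphi)Y=g(A\varphi X,Y)\xi-\eta(Y)A\varphi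 X$. Elliptic/hyperbolic (dimension 5): near each point there are smooth nowhere zero vector fields $V_1,V_2$ (unique up to sign) with $\varphi V_1=-V_1$, $\varphi V_2=V_2$, $g(V_1,V_2)=0$ and $AX=\varepsilon\left(g(X,V_1)V_1+\sigma g(X,V_2)V_2\right)$, $\varepsilon=\pm1$, where $\sigma=1$ in the elliptic and $\sigma=-1$ in the hyperbolic case. Replacing $(\xi,\eta)$ by $(-\xi,-\eta)$ if necessary, it is always assumed that $\varepsilon=1$. An adopted frame is a local frame $(V_0=\xi,V_1,V_2,V_3,V_4)$ extending $(\xi,V_1,V_2)$ with $\varphi V_3=V_3$, $\varphi V_4=-V_4$ and such that the only non-zero coefficients of the metric are $g(\xi,\xi)=g(V_1,V_3)=g(V_2,V_4)=1$ (and the symmetric ones). Its metric-dual coframe is $\theta^i=g(\cdot,V_i)$. The associated 1-forms $\tau_1,\tau_2,\omega$ are determined by $\nabla_XV_1=\tau_1(X)V_1$, $\nabla_XV_2=\tau_2(X)V_2$, $\omega(X)=g(\nabla_XV_3,V_4)$. Conventions: for 1-forms, $(\alpha\wedge\beta)(X,Y)=\frac12(\alpha(X)\beta(Y)-\alpha(Y)\beta(X))$, $(\alpha\odot\beta)(X,Y)=\frac12(\alpha(X)\beta(Y)+\alpha(Y)\beta(X))$, $2d\alpha(X,Y)=X\alpha(Y)-Y\alpha(X)-\alpha([X,Y])$. For 2-forms $B,D$, $(B\cdot D)(X,Y,Z,W)=\frac12\left(B(X,Y)D(Z,W)+B(Z,W)D(X,Y)\right)$.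
   Formalization: The coefficient of Θ^12·Θ^12 in R is corrected from σ+2γ to σ+γ (the printed one fails whenever γ≠0), and the double eigenvalues of the Ricci operator are −α_2, −β_2 instead of α_2, β_2, with multiplicities taken algebraically. *)

(* Defs.v *)
From HB Require Import structures.
From mathcomp Require Import all_boot all_order all_algebra.
From mathcomp Require Import all_classical all_reals all_analysis.

Set Implicit Arguments.
Unset Strict Implicit.
Unset Printing Implicit Defensive.

Import Order.TTheory GRing.Theory Num.Theory.
Import numFieldNormedType.Exports.

Local Open Scope classical_set_scope.
Local Open Scope ring_scope.

(** * Smooth manifolds *)

Fixpoint class_C (R : realType) (n k : nat) (O : set 'rV[R]_n)
    (f : 'rV[R]_n -> R) : Prop :=
  (forall x, O x -> {for x, continuous f}) /\
  if k is k'.+1 then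
    forall i : 'I_n,
      (forall x, O x -> derivable f x (delta_mx 0 i)) /\
      class_C k' O (fun x => 'D_(delta_mx 0 i) f x)
  else True.

Definition smooth_rV (R : realType) n (O : set 'rV[R]_n) (f : 'rV[R]_n -> R) :=
  forall k, class_C k O f.

Record chart (R : realType) (n : nat) (M : topologicalType) := Chart {
  chart_dom : set M ;
  chart_map : M -> 'rV[R]_n ;
  chart_inv : 'rV[R]_n -> M
}.

Definition chart_cod (R : realType) n (M : topologicalType)
  (c : chart R n M) : set 'rV[R]_n := chart_map c @` chart_dom c.

Record is_chart (R : realType) n (M : topologicalType) (c : chart R n M) :
    Prop := IsChart {
  chart_dom_open : open (chart_dom c) ;
  chart_cod_open : open (chart_cod c) ;
  chart_mapK : forall p, chart_dom c p -> chart_inv c (chart_map c p) = p ;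
  chart_map_cont :
    forall p, chart_dom c p -> {for p, continuous (chart_map c)} ;
  chart_inv_cont :
    forall x, chart_cod c x -> {for x, continuous (chart_inv c)}
}.

Definition smooth_transition (R : realType) n (M : topologicalType)
    (c d : chart R n M) :=
  forall i : 'I_n,
    smooth_rV (chart_map c @` (chart_dom c `&` chart_dom d))
      (fun x => chart_map d (chart_inv c x) 0 i).

Record manifold (R : realType) (n : nat) := Manifold {
  carrier :> topologicalType ;
  atlas : set (chart R n carrier) ;
  manifold_hausdorff : hausdorff_space carrier ;
  manifold_second_countable : @second_countable carrier ;
  atlas_chart : forall c, atlas c -> is_chart c ;
  atlas_cover : forall p, exists2 c, atlas c & chart_dom c p ;
  atlas_smooth : forall c d, atlas c -> atlas d -> smooth_transition c d
}.

(** * Smooth functions, tangent vectors, vector fields *)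

Section Tangent.
Context (R : realType) (n : nat) (M : manifold R n).

(* Only meaningful for W open. *)
Definition smooth_on (W : set M) (f : M -> R) : Prop :=
  forall c, atlas c ->
    smooth_rV (chart_map c @` (chart_dom c `&` W)) (f \o chart_inv c).

Definition smooth_at (p : M) (f : M -> R) : Prop :=
  exists W : set M, [/\ open W, W p & smooth_on W f].

(* Tangent vectors at p are the derivations of the algebra of germs of smooth
   functions at p; the last clause makes a derivation determined by its values
   on functions that are smooth near p. *)
Record derivation_at (p : M) (v : (M -> R) -> R^o) : Prop := DerivationAt {
  derivation_linear : forall (a : R) f h, smooth_at p f -> smooth_at p h ->
    v (fun q => a * f q + h q) = a * v f + v h ;
  derivation_leibniz : forall f h, smooth_at p f -> smooth_at p h ->
    v (fun q => f q * h q) = f p * v h + h p * v f ;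
  derivation_local : forall f h,
    (exists W : set M, [/\ open W, W p & forall q, W q -> f q = h q]) ->
    v f = v h ;
  derivation_junk : forall f, ~ smooth_at p f -> v f = 0
}.

Definition tangent_pred (p : M) : {pred ((M -> R) -> R^o)} :=
  fun v => `[< derivation_at p v >].

Fact tangent_submod_closed p : submod_closed (tangent_pred p).
Proof.
split=> [|a u v /asboolP[ul um uloc uj] /asboolP[vl vm vloc vj]].
  by apply/asboolP; split=> *; rewrite /GRing.zero /= ?mulr0 ?addr0.
apply/asboolP; split.
- move=> b f h sf sh; change (a * u (fun q => b * f q + h q)
    + v (fun q => b * f q + h q) = b * (a * u f + v f) + (a * u h + v h)).
  by rewrite ul// vl// !mulrDr addrACA (mulrCA b).
- move=> f h sf sh; change (a * u (fun q => f q * h q)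
    + v (fun q => f q * h q) = f p * (a * u h + v h) + h p * (a * u f + v f)).
  by rewrite um// vm// !mulrDr addrACA (mulrCA (f p)) (mulrCA (h p)).
- move=> f h fh; change (a * u f + v f = a * u h + v h).
  by rewrite (uloc _ _ fh) (vloc _ _ fh).
- by move=> f nf; change (a * u f + v f = 0); rewrite uj// vj// mulr0 addr0.
Qed.

HB.instance Definition _ p :=
  GRing.isSubmodClosed.Build R _ (tangent_pred p) (tangent_submod_closed p).

Record tangent (p : M) := Tangent {
  tangent_val : (M -> R) -> R^o ;
  tangent_valP : tangent_val \in tangent_pred p
}.

HB.instance Definition _ p := [isSub for @tangent_val p].
HB.instance Definition _ p := [Choice of tangent p by <:].
HB.instance Definition _ p := [SubChoice_isSubLmodule of tangent p by <:].

Definition vfield := forall p : M, tangent p.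

Definition vaction (X : vfield) (f : M -> R) : M -> R :=
  fun p => tangent_val (X p) f.

Definition smooth_vfield (W : set M) (X : vfield) : Prop :=
  forall (W' : set M) f, open W' -> W' `<=` W ->
    smooth_on W' f -> smooth_on W' (vaction X f).

Definition bracket_val (X Y : vfield) (p : M) : (M -> R) -> R^o :=
  fun f => if `[< smooth_at p f >] then
    vaction X (vaction Y f) p - vaction Y (vaction X f) p else 0.

(* [bracket_val X Y p] is a derivation as soon as X and Y are smooth near p. *)
Definition bracket (X Y : vfield) : vfield :=
  fun p => insubd (0 : tangent p) (bracket_val X Y p).

(* Tensorial expressions are evaluated on tangent vectors by means of local
   extensions to smooth vector fields, on whose choice they do not depend. *)
Definition extension (p : M) (x : tangent p) : vfield :=
  xget (fun q => 0) [set X : vfield |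
    (exists W : set M, [/\ open W, W p & smooth_vfield W X]) /\ X p = x].

(** * Tensor fields and exterior calculus *)

Definition oneform := forall p : M, tangent p -> R.
Definition bilinear_field := forall p : M, tangent p -> tangent p -> R.
Definition endo_field := forall p : M, tangent p -> tangent p.

Definition smooth_oneform (a : oneform) : Prop :=
  (forall p c (x y : tangent p), a p (c *: x + y) = c * a p x + a p y) /\
  (forall (W : set M) X, open W -> smooth_vfield W X ->
     smooth_on W (fun p => a p (X p))).

Definition smooth_endo (phi : endo_field) : Prop :=
  (forall p c (x y : tangent p),
     phi p (c *: x + y) = c *: phi p x + phi p y) /\
  (forall (W : set M) X, open W -> smooth_vfield W X ->
     smooth_vfield W (fun p => phi p (X p))).

Record pseudo_riemannian (g : bilinear_field) : Prop := PseudoRiemannian {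
  metric_linear : forall p c (x y z : tangent p),
    g p (c *: x + y) z = c * g p x z + g p y z ;
  metric_sym : forall p (x y : tangent p), g p x y = g p y x ;
  metric_nondegenerate : forall p (x : tangent p),
    (forall y, g p x y = 0) -> x = 0 ;
  metric_smooth : forall (W : set M) X Y, open W ->
    smooth_vfield W X -> smooth_vfield W Y ->
    smooth_on W (fun p => g p (X p) (Y p))
}.

Definition wedge (a b : oneform) : bilinear_field :=
  fun p x y => 2^-1 * (a p x * b p y - a p y * b p x).

Definition symprod (a b : oneform) : bilinear_field :=
  fun p x y => 2^-1 * (a p x * b p y + a p y * b p x).

Definition prod2form (B D : bilinear_field) (p : M) (x y z w : tangent p) : R :=
  2^-1 * (B p x y * D p z w + B p z w * D p x y).

Definition ext_d1 (a : oneform) : bilinear_field := fun p x y =>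
  let X := extension x in let Y := extension y in
  2^-1 * (vaction X (fun q => a q (Y q)) p - vaction Y (fun q => a q (X q)) p
          - a p (bracket X Y p)).

Definition ext_d2 (B : bilinear_field) (p : M) (x y z : tangent p) : R :=
  let X := extension x in let Y := extension y in let Z := extension z in
  3^-1 * (vaction X (fun q => B q (Y q) (Z q)) p
          + vaction Y (fun q => B q (Z q) (X q)) p
          + vaction Z (fun q => B q (X q) (Y q)) p
          - B p (bracket X Y p) z - B p (bracket Y Z p) x
          - B p (bracket Z X p) y).

(** * Connections and curvature *)

Definition section (E : forall p : M, set (tangent p)) (W : set M)
    (X : vfield) : Prop :=
  smooth_vfield W X /\ forall p, W p -> E p (X p).

(* For E = setT this is the Levi-Civita connection of g. For E the tangent
   distribution of a foliation on whose leaves g is nondegenerate, it is the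
   family of the Levi-Civita connections of the metrics induced on the
   leaves, acting on vector fields tangent to the leaves. *)
Record levi_civita_along (E : forall p : M, set (tangent p))
    (g : bilinear_field) (nabla : vfield -> vfield -> vfield) : Prop :=
  LeviCivitaAlong {
  conn_section : forall (W : set M) X Y, open W ->
    section E W X -> section E W Y -> section E W (nabla X Y) ;
  conn_local : forall (W : set M) X X' Y Y', open W ->
    section E W X -> section E W X' -> section E W Y -> section E W Y' ->
    (forall p, W p -> X p = X' p) -> (forall p, W p -> Y p = Y' p) ->
    forall p, W p -> nabla X Y p = nabla X' Y' p ;
  conn_linear_l : forall (W : set M) f X X' Y, open W -> smooth_on W f ->
    section E W X -> section E W X' -> section E W Y ->
    forall p, W p -> nabla (fun q => f q *: X q + X' q) Y p
                     = f p *: nabla X Y p + nabla X' Y p ;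
  conn_leibniz_r : forall (W : set M) f X Y Y', open W -> smooth_on W f ->
    section E W X -> section E W Y -> section E W Y' ->
    forall p, W p -> nabla X (fun q => f q *: Y q + Y' q) p
      = f p *: nabla X Y p + vaction X f p *: Y p + nabla X Y' p ;
  conn_torsion_free : forall (W : set M) X Y, open W ->
    section E W X -> section E W Y ->
    forall p, W p -> nabla X Y p - nabla Y X p = bracket X Y p ;
  conn_metric : forall (W : set M) X Y Z, open W ->
    section E W X -> section E W Y -> section E W Z ->
    forall p, W p -> vaction X (fun q => g q (Y q) (Z q)) p
      = g p (nabla X Y p) (Z p) + g p (Y p) (nabla X Z p)
}.

Definition levi_civita (g : bilinear_field) (nabla : vfield -> vfield -> vfield)
  : Prop := levi_civita_along (fun p => setT) g nabla.

Definition covd (nabla : vfield -> vfield -> vfield) (p : M) (x : tangent p)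
  (Y : vfield) : tangent p := nabla (extension x) Y p.

Definition curvature (nabla : vfield -> vfield -> vfield) (X Y Z : vfield) :
    vfield := fun p =>
  nabla X (nabla Y Z) p - nabla Y (nabla X Z) p - nabla (bracket X Y) Z p.

Definition riemann (nabla : vfield -> vfield -> vfield) (p : M)
    (x y z : tangent p) : tangent p :=
  curvature nabla (extension x) (extension y) (extension z) p.

Definition riemann4 (g : bilinear_field) nabla (p : M)
  (x y z w : tangent p) : R := g p (riemann nabla x y z) w.

Definition is_basis (V : lmodType R) (m : nat) (e : 'I_m -> V) : Prop :=
  forall v : V, exists! c : 'rV[R]_m, v = \sum_i c 0 i *: e i.

(* The matrix of an endomorphism of T_p M in some basis; rows are the
   coordinates of the images of the basis vectors. *)
Definition mx_of_endo (p : M) (L : tangent p -> tangent p) : 'M[R]_n :=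
  xget 0 [set A : 'M[R]_n | exists2 e : 'I_n -> tangent p, is_basis e &
            forall i, L (e i) = \sum_j A i j *: e j].

Definition trace (p : M) (L : tangent p -> tangent p) : R :=
  \tr (mx_of_endo L).

(* The endomorphism metrically equivalent to a bilinear form. *)
Definition sharp (g : bilinear_field) (p : M) (B : tangent p -> tangent p -> R)
    (x : tangent p) : tangent p :=
  xget 0 [set v | forall y, g p v y = B x y].

Definition trace_g (g : bilinear_field) (p : M)
  (B : tangent p -> tangent p -> R) : R := trace (sharp g B).

Definition ricci (nabla : vfield -> vfield -> vfield) : bilinear_field :=
  fun p x y => trace (fun z => riemann nabla z x y).

Definition scalar_curvature (g : bilinear_field) nabla (p : M) : R :=
  trace_g g (@ricci nabla p).

End Tangent.

(** * Almost para-contact metric structures *)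

Record almost_paracontact_metric (R : realType) (n : nat)
    (M : manifold R n.*2.+1) (phi : endo_field M) (xi : vfield M)
    (eta : oneform M) (g : bilinear_field M) : Prop :=
  AlmostParacontactMetric {
  apc_phi_smooth : smooth_endo phi ;
  apc_xi_smooth : smooth_vfield setT xi ;
  apc_eta_smooth : smooth_oneform eta ;
  apc_metric : pseudo_riemannian g ;
  apc_phi2 : forall p (x : tangent p),
    phi p (phi p x) = x - eta p x *: xi p ;
  apc_eta_xi : forall p, eta p (xi p) = 1 ;
  apc_compatible : forall p (x y : tangent p),
    g p (phi p x) (phi p y) = - g p x y + eta p x * eta p y ;
  apc_eta_dual : forall p (x : tangent p), eta p x = g p (xi p) x
}.

Section Paracosymplectic.
Context (R : realType) (m : nat) (M : manifold R m).
Context (phi : endo_field M) (xi : vfield M) (eta : oneform M).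
Context (g : bilinear_field M) (nabla : vfield M -> vfield M -> vfield M).

Definition fundamental_form : bilinear_field M := fun p x y => g (phi x) y.

Definition almost_paracosymplectic : Prop :=
  (forall p (x y : tangent p), ext_d1 eta x y = 0) /\
  (forall p (x y z : tangent p), ext_d2 fundamental_form x y z = 0).

Definition weakly_paracosymplectic : Prop :=
  almost_paracosymplectic /\
  forall p (x y z : tangent p),
    riemann nabla x y (phi z) = phi (riemann nabla x y z).

Definition leaf_tangent (p : M) : set (tangent p) := [set x | eta x = 0].

Definition parakahler_leaves : Prop :=
  exists2 nablaH : vfield M -> vfield M -> vfield M,
    levi_civita_along leaf_tangent g nablaH &
    forall (W : set M) X Y, open W ->
      section leaf_tangent W X -> section leaf_tangent W Y ->
      forall p, W p -> nablaH X (fun q => phi (Y q)) p = phi (nablaH X Y p).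

Definition shape (p : M) (x : tangent p) : tangent p := - covd nabla x xi.

(* The characteristic local fields V_1, V_2 of the elliptic (sigma = 1) and of
   the hyperbolic (sigma = -1) case, with the orientation of xi normalized so
   that epsilon = 1. *)
Record characteristic_fields (sigma : R) (W : set M) (V1 V2 : vfield M) :
    Prop := CharacteristicFields {
  char_smooth1 : smooth_vfield W V1 ;
  char_smooth2 : smooth_vfield W V2 ;
  char_neq0 : forall p, W p -> V1 p <> 0 /\ V2 p <> 0 ;
  char_phi1 : forall p, W p -> phi (V1 p) = - V1 p ;
  char_phi2 : forall p, W p -> phi (V2 p) = V2 p ;
  char_orth : forall p, W p -> g (V1 p) (V2 p) = 0 ;
  char_shape : forall p, W p -> forall x : tangent p,
    shape x = g x (V1 p) *: V1 p + (sigma * g x (V2 p)) *: V2 p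
}.

Definition elliptic_or_hyperbolic (sigma : R) : Prop :=
  forall p : M, exists (W : set M) V1 V2,
    [/\ open W, W p & characteristic_fields sigma W V1 V2].

End Paracosymplectic.

(** * Adopted frames in dimension 5 *)

Section AdoptedFrame.
Context (R : realType) (M : manifold R 5).
Context (phi : endo_field M) (xi : vfield M) (g : bilinear_field M).
Context (nabla : vfield M -> vfield M -> vfield M).

(* V_i pairs to 1 with V_(dual_index i) and to 0 with the other fields. *)
Definition dual_index (i : 'I_5) : 'I_5 := nth 0 [:: 0; 3; 4; 1; 2] i.

Record adopted_frame (sigma : R) (U : set M) (V : 'I_5 -> vfield M) : Prop :=
  AdoptedFrame {
  frame_open : open U ;
  frame_smooth : forall i, smooth_vfield U (V i) ;
  frame_basis : forall p, U p -> is_basis (fun i => V i p) ;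
  frame_xi : forall p, U p -> V 0 p = xi p ;
  frame_char : characteristic_fields phi xi g nabla sigma U (V 1) (V 2) ;
  frame_phi3 : forall p, U p -> phi (V 3 p) = V 3 p ;
  frame_phi4 : forall p, U p -> phi (V 4 p) = - V 4 p ;
  frame_gram : forall p, U p -> forall i j,
    g (V i p) (V j p) = (j == dual_index i)%:R
}.

Definition coframe (V : 'I_5 -> vfield M) (i : 'I_5) : oneform M :=
  fun p x => g x (V i p).

Record connection_forms (U : set M) (V : 'I_5 -> vfield M)
    (tau1 tau2 omega : oneform M) : Prop := ConnectionForms {
  conn_tau1 : forall p, U p -> forall x : tangent p,
    covd nabla x (V 1) = tau1 p x *: V 1 p ;
  conn_tau2 : forall p, U p -> forall x : tangent p,
    covd nabla x (V 2) = tau2 p x *: V 2 p ;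
  conn_omega : forall p, U p -> forall x : tangent p,
    omega p x = g (covd nabla x (V 3)) (V 4 p)
}.

Definition Domega (tau1 tau2 omega : oneform M) : bilinear_field M :=
  fun p x y => ext_d1 omega x y
    - wedge omega (fun q z => tau1 q z + tau2 q z) x y.

Definition Theta (V : 'I_5 -> vfield M) (i j : 'I_5) : bilinear_field M :=
  fun p x y => 2 * wedge (coframe V i) (coframe V j) x y.

Definition structure_equations (U : set M) (V : 'I_5 -> vfield M)
    (tau1 tau2 omega : oneform M) (alpha1 alpha2 beta1 beta2 gamma : M -> R) :
    Prop :=
  let th := coframe V in
  forall p, U p -> forall x y : tangent p,
  [/\ ext_d1 tau1 x y = alpha1 p * wedge (th 1) (th 2) x y
                        + alpha2 p * wedge (th 1) (th 3) x y,
      ext_d1 tau2 x y = beta1 p * wedge (th 1) (th 2) x y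
                        + beta2 p * wedge (th 2) (th 4) x y
    & Domega tau1 tau2 omega x y
      = gamma p * wedge (th 1) (th 2) x y
        - alpha1 p * wedge (th 1) (th 3) x y
        - beta1 p * wedge (th 2) (th 4) x y].

(* Since R(X,Y)V_1 = 2 dtau_1(X,Y) V_1, R(X,Y)V_2 = 2 dtau_2(X,Y) V_2 and
   R(X,Y,V_3,V_4) = (sigma Theta^12 + 2 Domega)(X,Y), where
   2 theta^i /\ theta^j = Theta^ij, the coefficient of Theta^12 . Theta^12 for
   the function gamma of [structure_equations] is sigma + gamma (and not
   sigma + 2 gamma). *)
Definition curvature_decomposition (sigma : R) (U : set M)
    (V : 'I_5 -> vfield M) (alpha1 alpha2 beta1 beta2 gamma : M -> R) : Prop :=
  let T := Theta V in
  forall p, U p -> forall x y z w : tangent p,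
  riemann4 g nabla x y z w =
    (sigma + gamma p) * prod2form (T 1 2) (T 1 2) x y z w
    - alpha2 p * prod2form (T 1 3) (T 1 3) x y z w
    - beta2 p * prod2form (T 2 4) (T 2 4) x y z w
    - 2 * (alpha1 p * prod2form (T 1 2) (T 1 3) x y z w
           + beta1 p * prod2form (T 1 2) (T 2 4) x y z w).

Definition ricci_decomposition (U : set M) (V : 'I_5 -> vfield M)
    (alpha1 alpha2 beta1 beta2 : M -> R) : Prop :=
  let th := coframe V in
  forall p, U p -> forall x y : tangent p,
  ricci nabla x y = trace_g g (fun z w => riemann4 g nabla z x y w) /\
  ricci nabla x y =
    - 2 * alpha2 p * symprod (th 1) (th 3) x y
    - 2 * beta2 p * symprod (th 2) (th 4) x y
    - 2 * (alpha1 p - beta1 p) * symprod (th 1) (th 2) x y.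

(* The characteristic polynomial is that of the operator Q determined by
   g(QX, Y) = Ric(X, Y), whose trace is the scalar curvature. By
   [ricci_decomposition], Q V_1 = - alpha2 V_1 and Q V_2 = - beta2 V_2, whence
   the signs; multiplicities are algebraic. *)
Definition ricci_eigenfunctions (U : set M) (alpha2 beta2 : M -> R) : Prop :=
  forall p, U p ->
  char_poly (mx_of_endo (sharp g (@ricci _ _ M nabla p)))
  = 'X * ('X - (- alpha2 p)%:P) ^+ 2 * ('X - (- beta2 p)%:P) ^+ 2.

End AdoptedFrame.

(* Main.v *)
(* From [nabla V_1 = tau_1 V_1] and [nabla V_2 = tau_2 V_2] one gets
   [R(X,Y)V_1 = 2 dtau_1(X,Y) V_1] and [R(X,Y)V_2 = 2 dtau_2(X,Y) V_2]; weak
   para-cosymplecticity gives [R(X,Y)xi = 0]; and the metric, the shape operator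
   and [omega] determine the connection on [V_3] and [V_4], whence
   [R(X,Y,V_3,V_4) = (sigma Theta^12 + 2 Domega)(X,Y)]. By skew-symmetry,
   [R = - 2 dtau_1 (x) Theta^13 - 2 dtau_2 (x) Theta^24
        + (sigma Theta^12 + 2 Domega) (x) Theta^12],
   so by pair symmetry the 2-forms on the left are combinations of [Theta^12],
   [Theta^13] and [Theta^24] with a symmetric matrix of coefficients, in which
   [R(V_1,V_3,V_2,V_4)] vanishes by the first Bianchi identity. The Ricci
   operator is then triangular in the frame. Two adopted frames share
   [+-V_1], [+-V_2] because these are determined by the shape operator. *)

Require Import Defs.
From HB Require Import structures.
From mathcomp Require Import all_boot all_order all_algebra.
From mathcomp Require Import all_classical all_reals all_analysis.
From mathcomp Require Import ring lra.

Set Implicit Arguments.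
Unset Strict Implicit.
Unset Printing Implicit Defensive.

Import Order.TTheory GRing.Theory Num.Theory.
Import numFieldNormedType.Exports.

Local Open Scope classical_set_scope.
Local Open Scope ring_scope.

(** * Smooth functions *)

Section ClassC.
Context (R : realType) (n : nat).
Implicit Types (O : set 'rV[R]_n) (f h : 'rV[R]_n -> R).

Lemma class_C_sub k O O' f : O' `<=` O -> class_C k O f -> class_C k O' f.
Proof.
move=> sO; elim: k f => [|k IH] f [cf df]; split=> //.
- by move=> x /sO /cf.
- by move=> x /sO /cf.
- by move=> i; have [d1 d2] := df i; split=> [x /sO /d1 //|]; exact: IH.
Qed.

Lemma class_C_ext k O f h : open O -> (forall x, O x -> f x = h x) ->
  class_C k O f -> class_C k O h.
Proof.
move=> oO.
have nfh f' h' x : (forall x, O x -> f' x = h' x) -> O x -> {near x, f' =1 h'}.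
  by move=> fh Ox; apply: filterS (open_nbhs_nbhs (conj oO Ox)) => y /fh.
have cont f' h' : (forall x, O x -> f' x = h' x) ->
    (forall x, O x -> {for x, continuous f'}) ->
    forall x, O x -> {for x, continuous h'}.
  move=> fh cf x Ox; change (h' y @[y --> x] --> h' x); rewrite -(fh _ Ox).
  by apply: cvg_trans (cf _ Ox); apply: (@near_eq_cvg _ _ (nbhs x)); exact: nfh.
elim: k f h => [|k IH] f h fh [cf df]; split=> //; try exact: cont cf.
move=> i; have [d1 d2] := df i; split=> [x Ox|].
  by apply: near_eq_derivable (d1 _ Ox); exact: nfh.
by apply: IH d2 => x Ox; apply: near_eq_derive; exact: nfh.
Qed.

Lemma class_C_pred k O f : class_C k.+1 O f -> class_C k O f.
Proof.
elim: k f => [|k IH] f [cf df]; split=> // i.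
by have [d1 d2] := df i; split=> //; exact: IH.
Qed.

Lemma class_C_cst k O a : open O -> class_C k O (fun=> a).
Proof.
move=> oO; elim: k a => [|k IH] a; first by split=> // x _; exact: cst_continuous.
split=> [x _|i]; first exact: cst_continuous.
split=> [x _|]; first exact: derivable_cst.
by apply: class_C_ext (IH 0) => // x Ox; rewrite derive_cst.
Qed.

Lemma class_C_add k O f h : open O -> class_C k O f -> class_C k O h ->
  class_C k O (fun x => f x + h x).
Proof.
move=> oO; elim: k f h => [|k IH] f h [cf df] [ch dh].
  by split=> // x Ox; apply: continuousD; [exact: cf|exact: ch].
split=> [x Ox|i]; first by apply: continuousD; [exact: cf|exact: ch].
have [df1 df2] := df i; have [dh1 dh2] := dh i.
split=> [x Ox|]; first by apply: derivableD; [exact: df1|exact: dh1].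
apply: class_C_ext (IH _ _ df2 dh2) => // x Ox.
by rewrite -deriveD//; [exact: df1|exact: dh1].
Qed.

Lemma class_C_mul k O f h : open O -> class_C k O f -> class_C k O h ->
  class_C k O (fun x => f x * h x).
Proof.
move=> oO; elim: k f h => [|k IH] f h Cf Ch.
  have [cf _] := Cf; have [ch _] := Ch.
  by split=> // x Ox; apply: continuousM; [exact: cf|exact: ch].
have [cf df] := Cf; have [ch dh] := Ch.
split=> [x Ox|i]; first by apply: continuousM; [exact: cf|exact: ch].
have [df1 df2] := df i; have [dh1 dh2] := dh i.
split=> [x Ox|]; first by apply: derivableM; [exact: df1|exact: dh1].
have C1 := IH _ _ (class_C_pred Cf) dh2; have C2 := IH _ _ (class_C_pred Ch) df2.
apply: class_C_ext (class_C_add oO C1 C2) => // x Ox.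
by rewrite (deriveM (df1 _ Ox) (dh1 _ Ox)).
Qed.

End ClassC.

Section SmoothFunctions.
Context (R : realType) (n : nat) (M : manifold R n).
Implicit Types (W : set M) (f h : M -> R).

Lemma chart_image_open (c : chart R n M) W : is_chart c -> open W ->
  open (chart_map c @` (chart_dom c `&` W)).
Proof.
move=> Cc oW.
rewrite openE => _ [p [cp Wp] <-]; rewrite /interior.
have kx : chart_cod c (chart_map c p) by exists p.
have n1 : nbhs (chart_map c p) (chart_cod c).
  by apply: open_nbhs_nbhs; split=> //; exact: chart_cod_open.
have n2 : nbhs (chart_map c p) (chart_inv c @^-1` W).
  apply: (chart_inv_cont Cc kx).
  by rewrite (chart_mapK Cc)//; apply: open_nbhs_nbhs.
apply: filterS2 n1 n2 => _ [q cq <-] Wq; exists q => //.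
by split=> //; rewrite -(chart_mapK Cc cq).
Qed.

Lemma smooth_on_sub W W' f : W' `<=` W -> smooth_on W f -> smooth_on W' f.
Proof.
move=> sW sf c ac k; apply: class_C_sub (sf c ac k).
by move=> _ [p [cp W'p] <-]; exists p => //; split=> //; exact: sW.
Qed.

Lemma smooth_on_ext W f h : open W -> (forall p, W p -> f p = h p) ->
  smooth_on W f -> smooth_on W h.
Proof.
move=> oW fh sf c ac k; apply: class_C_ext (sf c ac k).
  exact: chart_image_open (atlas_chart ac) oW.
by move=> _ [p [cp Wp] <-] /=; rewrite (chart_mapK (atlas_chart ac))// fh.
Qed.

Lemma smooth_on_cst W (a : R) : open W -> smooth_on W (fun=> a).
Proof.
by move=> oW c ac k; apply: class_C_cst; exact: chart_image_open (atlas_chart ac) oW.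
Qed.

Lemma smooth_on_add W f h : open W -> smooth_on W f -> smooth_on W h ->
  smooth_on W (fun p => f p + h p).
Proof.
move=> oW sf sh c ac k; apply: class_C_add (sf c ac k) (sh c ac k).
exact: chart_image_open (atlas_chart ac) oW.
Qed.

Lemma smooth_on_mul W f h : open W -> smooth_on W f -> smooth_on W h ->
  smooth_on W (fun p => f p * h p).
Proof.
move=> oW sf sh c ac k; apply: class_C_mul (sf c ac k) (sh c ac k).
exact: chart_image_open (atlas_chart ac) oW.
Qed.

Lemma smooth_on_sub_fun W f h : open W -> smooth_on W f -> smooth_on W h ->
  smooth_on W (fun p => f p - h p).
Proof.
move=> oW sf sh; have sm := smooth_on_mul oW (smooth_on_cst (-1) oW) sh.
by apply: smooth_on_ext (smooth_on_add oW sf sm) => // p _; rewrite mulN1r.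
Qed.

End SmoothFunctions.

(** * Vector fields *)

Section VectorFields.
Context (R : realType) (n : nat) (M : manifold R n).
Implicit Types (p q : M) (W : set M) (f h : M -> R) (X Y Z : vfield M).

Lemma smooth_on_at W p f : open W -> W p -> smooth_on W f -> smooth_at p f.
Proof. by move=> oW Wp sf; exists W. Qed.

Lemma tangent_derivation p (x : tangent p) : derivation_at p (tangent_val x).
Proof. by apply/asboolP; exact: (tangent_valP x). Qed.

Lemma tangent_valD p (x y : tangent p) f :
  tangent_val (x + y) f = tangent_val x f + tangent_val y f.
Proof. by []. Qed.

Lemma tangent_valN p (x : tangent p) f : tangent_val (- x) f = - tangent_val x f.
Proof. by []. Qed.

Lemma tangent_eq p (x y : tangent p) :
  (forall f, smooth_at p f -> tangent_val x f = tangent_val y f) -> x = y.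
Proof.
move=> xy; apply: val_inj; apply/funext => f /=.
have [/xy //|nf] := pselect (smooth_at p f).
by rewrite !(derivation_junk (tangent_derivation _)).
Qed.

Lemma smooth_at_common p f h : smooth_at p f -> smooth_at p h ->
  exists W, [/\ open W, W p, smooth_on W f & smooth_on W h].
Proof.
move=> [A [oA Ap sA]] [B [oB Bp sB]]; exists (A `&` B); split=> //.
- exact: openI.
- by apply: smooth_on_sub sA => q [].
- by apply: smooth_on_sub sB => q [].
Qed.

Lemma vaction_local W X f h p : open W -> W p -> (forall q, W q -> f q = h q) ->
  vaction X f p = vaction X h p.
Proof.
by move=> oW Wp fh; apply: (derivation_local (tangent_derivation _)); exists W.
Qed.

Lemma vactionD X f h p : smooth_at p f -> smooth_at p h ->
  vaction X (fun q => f q + h q) p = vaction X f p + vaction X h p.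
Proof.
move=> sf sh.
have := derivation_linear (tangent_derivation (X p)) 1 sf sh.
rewrite mul1r => <-; congr tangent_val.
by apply/funext => q; rewrite mul1r.
Qed.

Lemma vaction_lin X a f h p : smooth_at p f -> smooth_at p h ->
  vaction X (fun q => a * f q + h q) p = a * vaction X f p + vaction X h p.
Proof. by move=> sf sh; exact: (derivation_linear (tangent_derivation _)). Qed.

Lemma vactionM X f h p : smooth_at p f -> smooth_at p h ->
  vaction X (fun q => f q * h q) p = f p * vaction X h p + h p * vaction X f p.
Proof. by move=> sf sh; exact: (derivation_leibniz (tangent_derivation _)). Qed.

Lemma vaction_cst X (a : R) p : vaction X (fun=> a) p = 0.
Proof.
have s b : smooth_at p (fun=> b : R).
  by apply: (@smooth_on_at setT) => //; [exact: openT|apply: smooth_on_cst; exact: openT].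
have double u : u = u + u :> R -> u = 0.
  by move=> /eqP; rewrite -subr_eq subrr => /eqP.
have v1 : vaction X (fun=> 1) p = 0.
  apply: double; rewrite -{1}(mul1r 1) [LHS](vactionM _ (s 1) (s 1)).
  by rewrite !mul1r.
have v0 : vaction X (fun=> 0) p = 0.
  by apply: double; rewrite -{1}(addr0 0) [LHS](vactionD _ (s 0) (s 0)).
have -> : (fun=> a) = (fun=> a * 1 + 0) :> (M -> R) by rewrite mulr1 addr0.
by rewrite [LHS](vaction_lin _ _ (s 1) (s 0)) v1 v0 mulr0 addr0.
Qed.

Lemma smooth_vfield_sub W W' X : W' `<=` W -> smooth_vfield W X -> smooth_vfield W' X.
Proof. by move=> sW sX A f oA sA; apply: sX => //; exact: subset_trans sW. Qed.

Lemma smooth_vaction W X f : open W -> smooth_vfield W X -> smooth_on W f ->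
  smooth_on W (vaction X f).
Proof. by move=> oW sX; exact: sX. Qed.

Lemma smooth_vfield_ext W X Y : (forall p, W p -> X p = Y p) ->
  smooth_vfield W X -> smooth_vfield W Y.
Proof.
move=> XY sX A f oA sA sf; apply: smooth_on_ext (sX _ _ oA sA sf) => // p Ap.
by rewrite /vaction XY//; exact: sA.
Qed.

Lemma smooth_vfield0 W : smooth_vfield W (fun=> 0).
Proof.
move=> A f oA _ _; apply: smooth_on_ext (smooth_on_cst 0 oA) => //.
Qed.

Lemma smooth_vfield_lin W f X Y : open W -> smooth_on W f ->
  smooth_vfield W X -> smooth_vfield W Y ->
  smooth_vfield W (fun q => f q *: X q + Y q).
Proof.
move=> oW sf sX sY A h oA sA sh.
exact: (smooth_on_add oA (smooth_on_mul oA (smooth_on_sub sA sf) (sX _ _ oA sA sh))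
                 (sY _ _ oA sA sh)).
Qed.

Lemma smooth_vfieldD W X Y : open W -> smooth_vfield W X -> smooth_vfield W Y ->
  smooth_vfield W (fun q => X q + Y q).
Proof.
move=> oW sX sY.
apply: smooth_vfield_ext (smooth_vfield_lin oW (smooth_on_cst 1 oW) sX sY) => p _.
by rewrite scale1r.
Qed.

Lemma smooth_vfieldN W X : open W -> smooth_vfield W X ->
  smooth_vfield W (fun q => - X q).
Proof.
move=> oW sX.
apply: smooth_vfield_ext
  (smooth_vfield_lin oW (smooth_on_cst (-1) oW) sX (@smooth_vfield0 W)) => p _.
by rewrite scaleN1r addr0.
Qed.

Lemma smooth_vfieldB W X Y : open W -> smooth_vfield W X -> smooth_vfield W Y ->
  smooth_vfield W (fun q => X q - Y q).
Proof. by move=> oW sX sY; apply: smooth_vfieldD => //; exact: smooth_vfieldN. Qed.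

Lemma bracket_derivation W X Y p : open W -> W p ->
  smooth_vfield W X -> smooth_vfield W Y -> derivation_at p (bracket_val X Y p).
Proof.
move=> oW Wp sX sY.
have smooth_act A Z f : open A -> A `<=` W -> smooth_vfield W Z -> smooth_on A f ->
  smooth_on A (vaction Z f) by move=> oA sA sZ; exact: sZ.
have common f h : smooth_at p f -> smooth_at p h ->
    exists A, [/\ open A, A p, A `<=` W, smooth_on A f & smooth_on A h].
  move=> sf sh; have [A [oA Ap fA hA]] := smooth_at_common sf sh.
  exists (A `&` W); split=> //; first exact: openI.
  - by apply: smooth_on_sub fA => q [].
  - by apply: smooth_on_sub hA => q [].
split=> [a f h sf sh|f h sf sh|f h|f nf].
- have [A [oA Ap sA fA hA]] := common _ _ sf sh.
  have at_ q u : A q -> smooth_on A u -> smooth_at q u.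
    by move=> Aq; exact: smooth_on_at.
  have lin Z u v q : A q -> smooth_on A u -> smooth_on A v ->
      vaction Z (fun q => a * u q + v q) q = a * vaction Z u q + vaction Z v q.
    by move=> Aq su sv; apply: vaction_lin; exact: at_.
  have sfh : smooth_at p (fun q => a * f q + h q).
    apply: at_ => //; apply: smooth_on_add => //; apply: smooth_on_mul => //.
    exact: smooth_on_cst.
  rewrite /bracket_val !asboolT//.
  rewrite (@vaction_local A X _ (fun q => a * vaction Y f q + vaction Y h q))//;
    last by move=> q Aq; exact: lin.
  rewrite (@vaction_local A Y _ (fun q => a * vaction X f q + vaction X h q))//;
    last by move=> q Aq; exact: lin.
  rewrite !lin//; try exact: smooth_act.
  by rewrite mulrBr opprD addrACA.
- have [A [oA Ap sA fA hA]] := common _ _ sf sh.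
  have at_ q u : A q -> smooth_on A u -> smooth_at q u.
    by move=> Aq; exact: smooth_on_at.
  have mul Z u v q : A q -> smooth_on A u -> smooth_on A v ->
      vaction Z (fun q => u q * v q) q = u q * vaction Z v q + v q * vaction Z u q.
    by move=> Aq su sv; apply: vactionM; exact: at_.
  have sfh : smooth_at p (fun q => f q * h q).
    by apply: at_ => //; apply: smooth_on_mul.
  have second Z Z' : smooth_vfield W Z -> smooth_vfield W Z' ->
      vaction Z (vaction Z' (fun q => f q * h q)) p =
      f p * vaction Z (vaction Z' h) p + vaction Z' h p * vaction Z f p
      + (h p * vaction Z (vaction Z' f) p + vaction Z' f p * vaction Z h p).
    move=> sZ sZ'.
    have sZf := smooth_act _ _ _ oA sA sZ' fA.
    have sZh := smooth_act _ _ _ oA sA sZ' hA.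
    rewrite (@vaction_local A Z _
       (fun q => f q * vaction Z' h q + h q * vaction Z' f q))//;
      last by move=> q Aq; exact: mul.
    rewrite vactionD; first (by rewrite !mul); by apply: at_ => //; exact: smooth_on_mul.
  rewrite /bracket_val !asboolT// !second//.
  by ring.
- move=> [A [oA Ap fh]].
  have sub q : (A `&` W) q -> f q = h q by case=> /fh.
  have oAW : open (A `&` W) by exact: openI.
  have loc Z q : (A `&` W) q -> vaction Z f q = vaction Z h q.
    by move=> Aq; exact: (@vaction_local (A `&` W)).
  have sw (u v : M -> R) : (forall q, A q -> u q = v q) -> smooth_at p u -> smooth_at p v.
    move=> uv [B [oB Bp sB]]; exists (B `&` A); split=> //; first exact: openI.
    apply: (@smooth_on_ext _ _ _ _ u) => [|q [_ /uv] //|]; first exact: openI.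
    by apply: smooth_on_sub sB => q [].
  have E : smooth_at p f <-> smooth_at p h.
    by split; apply: sw => // q /fh.
  rewrite /bracket_val; have [sf|nf] := pselect (smooth_at p f).
    rewrite !asboolT//; last exact/E.
    by congr (_ - _); apply: (@vaction_local (A `&` W)) => // q; exact: loc.
  by rewrite !asboolF// => /E.
- by rewrite /bracket_val asboolF.
Qed.

Lemma bracket_action W X Y f p : open W -> W p ->
  smooth_vfield W X -> smooth_vfield W Y -> smooth_at p f ->
  vaction (bracket X Y) f p = vaction X (vaction Y f) p - vaction Y (vaction X f) p.
Proof.
move=> oW Wp sX sY sf.
have bE : tangent_val (bracket X Y p) = bracket_val X Y p.
  by apply: insubdK; apply/asboolP; exact: bracket_derivation sX sY.
by rewrite {1}/vaction bE /bracket_val asboolT.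
Qed.

Lemma smooth_bracket W X Y : open W -> smooth_vfield W X -> smooth_vfield W Y ->
  smooth_vfield W (bracket X Y).
Proof.
move=> oW sX sY A f oA sA sf.
apply: (@smooth_on_ext _ _ _ A
  (fun p => vaction X (vaction Y f) p - vaction Y (vaction X f) p)) => // [p Ap|].
  by rewrite (bracket_action oW _ sX sY)//; [exact: sA|exact: smooth_on_at sf].
apply: smooth_on_sub_fun => //.
  by apply: sX => //; exact: sY.
by apply: sY => //; exact: sX.
Qed.

Lemma bracketC W X Y p : open W -> W p -> smooth_vfield W X -> smooth_vfield W Y ->
  bracket Y X p = - bracket X Y p.
Proof.
move=> oW Wp sX sY; apply: tangent_eq => f sf; rewrite tangent_valN.
change (vaction (bracket Y X) f p = - vaction (bracket X Y) f p).
by rewrite !(@bracket_action W)// opprB.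
Qed.

Lemma jacobi W X Y Z p : open W -> W p ->
  smooth_vfield W X -> smooth_vfield W Y -> smooth_vfield W Z ->
  bracket X (bracket Y Z) p + bracket Y (bracket Z X) p
  + bracket Z (bracket X Y) p = 0.
Proof.
move=> oW Wp sX sY sZ; apply: tangent_eq => f [A [oA Ap sf]].
pose B := A `&` W.
have oB : open B by exact: openI.
have Bp : B p by [].
have BA : B `<=` A by move=> q [].
have BW : B `<=` W by move=> q [].
have fB := smooth_on_sub BA sf.
have {}sX := smooth_vfield_sub BW sX.
have {}sY := smooth_vfield_sub BW sY.
have {}sZ := smooth_vfield_sub BW sZ.
have sb := smooth_bracket oB.
have act X' Y' q u : smooth_vfield B X' -> smooth_vfield B Y' -> smooth_on B u -> B q ->
    vaction (bracket X' Y') u q = vaction X' (vaction Y' u) q - vaction Y' (vaction X' u) q.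
  by move=> sX' sY' su Bq; apply: (@bracket_action B) => //; exact: smooth_on_at su.
have act2 X' Y' Z' : smooth_vfield B X' -> smooth_vfield B Y' -> smooth_vfield B Z' ->
    vaction (bracket X' (bracket Y' Z')) f p =
    vaction X' (vaction Y' (vaction Z' f)) p - vaction X' (vaction Z' (vaction Y' f)) p
    - (vaction Y' (vaction Z' (vaction X' f)) p - vaction Z' (vaction Y' (vaction X' f)) p).
  move=> sX' sY' sZ'; have sXf := smooth_vaction oB sX' fB.
  have sYf := smooth_vaction oB sY' fB; have sZf := smooth_vaction oB sZ' fB.
  have sYZf := smooth_vaction oB sY' sZf; have sZYf := smooth_vaction oB sZ' sYf.
  rewrite act//; last exact: sb.
  congr (_ - _); last exact: act.
  rewrite (@vaction_local B X' _
    (fun q => 1 * vaction Y' (vaction Z' f) q + (-1) * vaction Z' (vaction Y' f) q))//;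
    last by move=> q Bq; rewrite act// mul1r mulN1r.
  have sN := smooth_on_mul oB (smooth_on_cst (-1) oB) sZYf.
  rewrite vaction_lin; try exact: smooth_on_at Bp _.
  rewrite mul1r vactionM; try exact: smooth_on_at Bp _.
    by rewrite vaction_cst mulr0 addr0 mulN1r.
  exact: smooth_on_at (smooth_on_cst _ oB).
rewrite !tangent_valD.
change (vaction (bracket X (bracket Y Z)) f p + vaction (bracket Y (bracket Z X)) f p
  + vaction (bracket Z (bracket X Y)) f p = 0).
rewrite !act2//.
by ring.
Qed.

Lemma endo0 (phi : endo_field M) p : smooth_endo phi -> phi p 0 = 0.
Proof.
by move=> [phil _]; have := phil p (-1) 0 0; rewrite !scaleN1r oppr0 addr0 addNr.
Qed.

Lemma endoZ (phi : endo_field M) p c (x : tangent p) : smooth_endo phi ->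
  phi p (c *: x) = c *: phi p x.
Proof.
by move=> sphi; have [phil _] := sphi; rewrite -[c *: x]addr0 phil endo0// addr0.
Qed.

End VectorFields.

(** * Symmetries of the curvature *)

Section CurvatureSymmetries.
Context (R : realFieldType) (T : Type) (D : T -> Prop) (K : T -> T -> T -> T -> R).
Hypothesis skewl : forall x y z w, D x -> D y -> D z -> D w -> K y x z w = - K x y z w.
Hypothesis skewr : forall x y z w, D x -> D y -> D z -> D w -> K x y w z = - K x y z w.
Hypothesis bianchi : forall x y z w, D x -> D y -> D z -> D w ->
  K x y z w + K y z x w + K z x y w = 0.

Lemma pair_symmetry x y z w : D x -> D y -> D z -> D w -> K x y z w = K z w x y.
Proof.
move=> Dx Dy Dz Dw.
have := bianchi Dx Dy Dz Dw; have := bianchi Dy Dz Dw Dx.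
have := bianchi Dz Dw Dx Dy; have := bianchi Dw Dx Dy Dz.
have := skewr Dy Dz Dx Dw; have := skewr Dz Dw Dx Dy.
have := skewl Dy Dw Dz Dx; have := skewr Dy Dw Dx Dz.
have := skewr Dw Dx Dy Dz; have := skewl Dz Dx Dw Dy.
have := skewr Dz Dx Dy Dw; have := skewr Dx Dy Dz Dw.
by lra.
Qed.

End CurvatureSymmetries.

Section LeviCivita.
Context (R : realType) (n : nat) (M : manifold R n).
Context (g : bilinear_field M) (nabla : vfield M -> vfield M -> vfield M).
Hypothesis gP : pseudo_riemannian g.
Hypothesis lc : levi_civita g nabla.
Implicit Types (p q : M) (W : set M) (f h : M -> R) (X Y Z T : vfield M).

Lemma gDl p (x y z : tangent p) : g (x + y) z = g x z + g y z.
Proof. by rewrite -[x]scale1r (metric_linear gP) scale1r mul1r. Qed.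

Lemma g0l p (x : tangent p) : g 0 x = 0.
Proof. by apply: (addrI (g 0 x)); rewrite -gDl !addr0. Qed.

Lemma gZl p a (x y : tangent p) : g (a *: x) y = a * g x y.
Proof. by rewrite -[a *: x]addr0 (metric_linear gP) g0l addr0. Qed.

Lemma gNl p (x y : tangent p) : g (- x) y = - g x y.
Proof. by rewrite -scaleN1r gZl mulN1r. Qed.

Lemma gBl p (x y z : tangent p) : g (x - y) z = g x z - g y z.
Proof. by rewrite gDl gNl. Qed.

Lemma gDr p (x y z : tangent p) : g x (y + z) = g x y + g x z.
Proof. by rewrite !(Defs.metric_sym gP x) gDl. Qed.

Lemma gZr p a (x y : tangent p) : g x (a *: y) = a * g x y.
Proof. by rewrite !(Defs.metric_sym gP x) gZl. Qed.

Lemma gNr p (x y : tangent p) : g x (- y) = - g x y.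
Proof. by rewrite !(Defs.metric_sym gP x) gNl. Qed.

Lemma g_sumr p (I : Type) (s : seq I) (P : pred I) x (F : I -> tangent p) :
  g x (\sum_(i <- s | P i) F i) = \sum_(i <- s | P i) g x (F i).
Proof.
apply: (big_ind2 (fun u v => g x u = v)) => // [|u u' v v' <- <-]; last exact: gDr.
by rewrite (Defs.metric_sym gP) g0l.
Qed.

Lemma g_suml p (I : Type) (s : seq I) (P : pred I) x (F : I -> tangent p) :
  g (\sum_(i <- s | P i) F i) x = \sum_(i <- s | P i) g (F i) x.
Proof.
rewrite (Defs.metric_sym gP) g_sumr; apply: eq_bigr => i _; exact: (Defs.metric_sym gP).
Qed.

Lemma g_eq p (x y : tangent p) : (forall z, g x z = g y z) -> x = y.
Proof.
move=> xy; apply/eqP; rewrite -subr_eq0; apply/eqP.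
by apply: (metric_nondegenerate gP) => z; rewrite gBl xy subrr.
Qed.

Lemma smooth_section W X : smooth_vfield W X -> section (fun p => setT) W X.
Proof. by []. Qed.

Lemma nabla_smooth W X Y : open W -> smooth_vfield W X -> smooth_vfield W Y ->
  smooth_vfield W (nabla X Y).
Proof.
move=> oW sX sY.
by have [] := conn_section lc oW (smooth_section sX) (smooth_section sY).
Qed.

Lemma nabla_local W X X' Y Y' p : open W -> W p ->
  smooth_vfield W X -> smooth_vfield W Y ->
  (forall q, W q -> X q = X' q) -> (forall q, W q -> Y q = Y' q) ->
  nabla X Y p = nabla X' Y' p.
Proof.
move=> oW Wp sX sY XX' YY'.
apply: (conn_local lc oW (smooth_section sX) _ (smooth_section sY) _ XX' YY' Wp).
  exact: smooth_section (smooth_vfield_ext XX' sX).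
exact: smooth_section (smooth_vfield_ext YY' sY).
Qed.

Lemma nabla_linl W f X X' Y p : open W -> W p -> smooth_on W f ->
  smooth_vfield W X -> smooth_vfield W X' -> smooth_vfield W Y ->
  nabla (fun q => f q *: X q + X' q) Y p = f p *: nabla X Y p + nabla X' Y p.
Proof. by move=> oW Wp sf sX sX' sY; exact: (conn_linear_l lc oW). Qed.

Lemma nabla0l W Y p : open W -> W p -> smooth_vfield W Y -> nabla (fun=> 0) Y p = 0.
Proof.
move=> oW Wp sY; have s0 := @smooth_vfield0 _ _ M W.
have := nabla_linl oW Wp (smooth_on_cst (-1) oW) s0 s0 sY.
rewrite scaleN1r addNr => <-.
by apply: (@nabla_local W) => // q _; rewrite scaler0 addr0.
Qed.

Lemma nablaNl W X Y p : open W -> W p -> smooth_vfield W X -> smooth_vfield W Y ->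
  nabla (fun q => - X q) Y p = - nabla X Y p.
Proof.
move=> oW Wp sX sY; have s0 := @smooth_vfield0 _ _ M W.
have := nabla_linl oW Wp (smooth_on_cst (-1) oW) sX s0 sY.
rewrite (nabla0l oW)// addr0 scaleN1r => <-.
apply: (@nabla_local W) => //; first exact: smooth_vfieldN.
by move=> q _; rewrite addr0 scaleN1r.
Qed.

Lemma nabla_leibniz W f X Y Y' p : open W -> W p -> smooth_on W f ->
  smooth_vfield W X -> smooth_vfield W Y -> smooth_vfield W Y' ->
  nabla X (fun q => f q *: Y q + Y' q) p =
  f p *: nabla X Y p + vaction X f p *: Y p + nabla X Y' p.
Proof. by move=> oW Wp sf sX sY sY'; exact: (conn_leibniz_r lc oW). Qed.

Lemma nablaBr W X Y Y' p : open W -> W p ->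
  smooth_vfield W X -> smooth_vfield W Y -> smooth_vfield W Y' ->
  nabla X (fun q => Y q - Y' q) p = nabla X Y p - nabla X Y' p.
Proof.
move=> oW Wp sX sY sY'.
have := nabla_leibniz oW Wp (smooth_on_cst (-1) oW) sX sY' sY.
rewrite vaction_cst scale0r addr0 scaleN1r addrC => <-.
apply: (@nabla_local W) => //; first exact: smooth_vfieldB.
by move=> q _; rewrite scaleN1r addrC.
Qed.

Lemma nabla_zero_r W X p : open W -> W p -> smooth_vfield W X -> nabla X (fun=> 0) p = 0.
Proof.
move=> oW Wp sX; have s0 := @smooth_vfield0 _ _ M W.
rewrite -(subrr (nabla X (fun=> 0) p)) -(nablaBr oW Wp sX s0 s0).
by apply: (nabla_local oW Wp) => // q _; rewrite subrr.
Qed.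

Lemma nablaZr W f X Y p : open W -> W p -> smooth_on W f ->
  smooth_vfield W X -> smooth_vfield W Y ->
  nabla X (fun q => f q *: Y q) p = f p *: nabla X Y p + vaction X f p *: Y p.
Proof.
move=> oW Wp sf sX sY; have s0 := @smooth_vfield0 _ _ M W.
rewrite -[RHS]addr0 -(nabla_zero_r oW Wp sX) -(nabla_leibniz oW Wp sf sX sY s0).
apply: (nabla_local oW Wp) => // [|q _]; last by rewrite addr0.
apply: smooth_vfield_ext (smooth_vfield_lin oW sf sY s0) => q _.
by rewrite addr0.
Qed.

Lemma nabla_suml W (I : Type) (s : seq I) (f : I -> M -> R) (F : I -> vfield M) Y p :
  open W -> W p -> (forall i, smooth_on W (f i)) -> (forall i, smooth_vfield W (F i)) ->
  smooth_vfield W Y ->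
  smooth_vfield W (fun q => \sum_(i <- s) f i q *: F i q) /\
  nabla (fun q => \sum_(i <- s) f i q *: F i q) Y p = \sum_(i <- s) f i p *: nabla (F i) Y p.
Proof.
move=> oW Wp sf sF sY; elim: s => [|i s [IH1 IH2]].
  split; first by apply: smooth_vfield_ext (@smooth_vfield0 _ _ M W) => q _; rewrite big_nil.
  rewrite big_nil -(nabla0l oW Wp sY).
  apply: (nabla_local oW Wp) => // [|q _]; last by rewrite big_nil.
  by apply: smooth_vfield_ext (@smooth_vfield0 _ _ M W) => q _; rewrite big_nil.
have sE : smooth_vfield W (fun q => \sum_(j <- i :: s) f j q *: F j q).
  apply: smooth_vfield_ext (smooth_vfield_lin oW (sf i) (sF i) IH1) => q _.
  by rewrite big_cons.
split=> //; rewrite big_cons -IH2 -(nabla_linl oW Wp (sf i) (sF i) IH1 sY).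
by apply: (nabla_local oW Wp) => // q _; rewrite big_cons.
Qed.

Lemma torsion_free W X Y p : open W -> W p -> smooth_vfield W X -> smooth_vfield W Y ->
  nabla X Y p - nabla Y X p = bracket X Y p.
Proof. by move=> oW Wp sX sY; exact: (conn_torsion_free lc oW). Qed.

Lemma metric_compat W X Y Z p : open W -> W p ->
  smooth_vfield W X -> smooth_vfield W Y -> smooth_vfield W Z ->
  vaction X (fun q => g (Y q) (Z q)) p
  = g (nabla X Y p) (Z p) + g (Y p) (nabla X Z p).
Proof. by move=> oW Wp sX sY sZ; exact: (conn_metric lc oW). Qed.

Lemma curvature_smooth W X Y Z : open W ->
  smooth_vfield W X -> smooth_vfield W Y -> smooth_vfield W Z ->
  smooth_vfield W (curvature nabla X Y Z).
Proof.
move=> oW sX sY sZ.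
have sN X' Y' : smooth_vfield W X' -> smooth_vfield W Y' -> smooth_vfield W (nabla X' Y').
  exact: nabla_smooth.
apply: smooth_vfieldB => //; first apply: smooth_vfieldB => //;
  [exact/sN/sN|exact/sN/sN|apply: sN => //; exact: smooth_bracket].
Qed.

Lemma curvature_skewl W X Y Z p : open W -> W p ->
  smooth_vfield W X -> smooth_vfield W Y -> smooth_vfield W Z ->
  curvature nabla Y X Z p = - curvature nabla X Y Z p.
Proof.
move=> oW Wp sX sY sZ; rewrite /curvature.
have -> : nabla (bracket Y X) Z p = - nabla (bracket X Y) Z p.
  rewrite -(nablaNl oW)//; last exact: smooth_bracket.
  by apply: (@nabla_local W) => // [|q Wq]; [exact: smooth_bracket|exact: (bracketC oW)].
by rewrite opprK !opprB addrAC [in RHS]addrC addrAC.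
Qed.

Lemma curvature_skewr W X Y Z T p : open W -> W p ->
  smooth_vfield W X -> smooth_vfield W Y -> smooth_vfield W Z -> smooth_vfield W T ->
  g (curvature nabla X Y T p) (Z p) = - g (curvature nabla X Y Z p) (T p).
Proof.
move=> oW Wp sX sY sZ sT.
pose u q := g (Z q) (T q).
have sg A B : smooth_vfield W A -> smooth_vfield W B -> smooth_on W (fun q => g (A q) (B q)).
  exact: (metric_smooth gP).
have su : smooth_on W u by exact: sg.
have second A B : smooth_vfield W A -> smooth_vfield W B ->
    vaction A (vaction B u) p =
    g (nabla A (nabla B Z) p) (T p) + g (nabla B Z p) (nabla A T p) +
    (g (nabla A Z p) (nabla B T p) + g (Z p) (nabla A (nabla B T) p)).
  move=> sA sB; have sBZ := nabla_smooth oW sB sZ; have sBT := nabla_smooth oW sB sT.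
  rewrite (@vaction_local _ _ _ W A _
    (fun q => g (nabla B Z q) (T q) + g (Z q) (nabla B T q)))//; last first.
    by move=> q Wq; exact: (metric_compat oW).
  rewrite vactionD; try by apply: (smooth_on_at oW Wp); exact: sg.
  by rewrite !(metric_compat oW).
have := bracket_action oW Wp sX sY (smooth_on_at oW Wp su).
rewrite !second// (metric_compat oW)//; last exact: smooth_bracket.
rewrite /curvature !gBl !(Defs.metric_sym gP (Z p)) => H.
by apply/eqP; rewrite -addr_eq0; apply/eqP; lra.
Qed.

Lemma bianchi_identity W X Y Z p : open W -> W p ->
  smooth_vfield W X -> smooth_vfield W Y -> smooth_vfield W Z ->
  curvature nabla X Y Z p + curvature nabla Y Z X p + curvature nabla Z X Y p = 0.
Proof.
move=> oW Wp sX sY sZ.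
have E A B C : smooth_vfield W A -> smooth_vfield W B -> smooth_vfield W C ->
    nabla A (nabla B C) p - nabla A (nabla C B) p - nabla (bracket B C) A p
    = bracket A (bracket B C) p.
  move=> sA sB sC; have sBC := nabla_smooth oW sB sC; have sCB := nabla_smooth oW sC sB.
  have sb := smooth_bracket oW sB sC.
  rewrite -(torsion_free oW _ sA sb)// -(nablaBr oW)//; congr (_ - _).
  apply: (@nabla_local W) => //; first exact: smooth_vfieldB.
  by move=> q Wq; exact: (torsion_free oW).
rewrite -(jacobi oW Wp sX sY sZ) -!E// /curvature.
by apply: tangent_eq => f _; rewrite !(tangent_valD, tangent_valN); ring.
Qed.

Definition smooth_near p X := exists W, [/\ open W, W p & smooth_vfield W X].

Lemma smooth_near_common p X Y Z T :
  smooth_near p X -> smooth_near p Y -> smooth_near p Z -> smooth_near p T ->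
  exists W, [/\ open W, W p & [/\ smooth_vfield W X, smooth_vfield W Y,
                                  smooth_vfield W Z & smooth_vfield W T]].
Proof.
move=> [A [oA Ap sA]] [B [oB Bp sB]] [C [oC Cp sC]] [D [oD Dp sD]].
exists (A `&` B `&` (C `&` D)); split; [|by []|].
  by apply: openI; exact: openI.
split; [apply: smooth_vfield_sub sA|apply: smooth_vfield_sub sB|
        apply: smooth_vfield_sub sC|apply: smooth_vfield_sub sD];
  by move=> q [[? ?] [? ?]].
Qed.

Lemma curvature_pair p X Y Z T :
  smooth_near p X -> smooth_near p Y -> smooth_near p Z -> smooth_near p T ->
  g (curvature nabla X Y Z p) (T p) = g (curvature nabla Z T X p) (Y p).
Proof.
pose K X Y Z T := g (curvature nabla X Y Z p) (T p).
move=> nX nY nZ nT.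
apply: (@pair_symmetry _ _ (smooth_near p) K) => // {nX nY nZ nT X Y Z T} X Y Z T nX nY nZ nT;
  have [W [oW Wp [sX sY sZ sT]]] := smooth_near_common nX nY nZ nT; rewrite /K.
- by rewrite (curvature_skewl oW Wp sX sY sZ) gNl.
- exact: (curvature_skewr oW).
- by rewrite -!gDl (bianchi_identity oW)// g0l.
Qed.

(* Skew-symmetry and pair symmetry carry the evident pointwise dependence on the
   last argument over to the other three. *)
Lemma curvature_pointwise p X Y Z T X' Y' Z' T' :
  smooth_near p X -> smooth_near p Y -> smooth_near p Z -> smooth_near p T ->
  smooth_near p X' -> smooth_near p Y' -> smooth_near p Z' -> smooth_near p T' ->
  X p = X' p -> Y p = Y' p -> Z p = Z' p -> T p = T' p ->
  g (curvature nabla X Y Z p) (T p) = g (curvature nabla X' Y' Z' p) (T' p).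
Proof.
move=> nX nY nZ nT nX' nY' nZ' nT' XX' YY' ZZ' TT'.
have skew A B C D : smooth_near p A -> smooth_near p B -> smooth_near p C ->
    smooth_near p D ->
    g (curvature nabla A B D p) (C p) = - g (curvature nabla A B C p) (D p).
  move=> nA nB nC nD; have [W [oW Wp [? ? ? ?]]] := smooth_near_common nA nB nC nD.
  exact: (curvature_skewr oW).
have right A B : smooth_near p A -> smooth_near p B ->
    g (curvature nabla A B Z p) (T p) = g (curvature nabla A B Z' p) (T' p).
  by move=> nA nB; rewrite TT' skew// ZZ' -skew.
rewrite right// curvature_pair// YY' skew// XX' -skew//.
by rewrite curvature_pair.
Qed.

End LeviCivita.

(** * Algebra in a null frame *)

Section Bases.
Context (R : realType) (n : nat) (M : manifold R n) (p : M).
Implicit Types (e : 'I_n -> tangent p) (L : tangent p -> tangent p).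

Lemma basis_free e (a b : 'rV[R]_n) : is_basis e ->
  \sum_i a 0 i *: e i = \sum_i b 0 i *: e i -> a = b.
Proof.
by move=> be ab; have [c [_ uc]] := be (\sum_i a 0 i *: e i); rewrite -(uc a)// -(uc b).
Qed.

Lemma basis_mx e (F : 'I_n -> tangent p) : is_basis e ->
  exists A : 'M[R]_n, forall i, F i = \sum_j A i j *: e j.
Proof.
move=> be; have c i : {c : 'rV[R]_n | F i = \sum_j c 0 j *: e j}.
  by apply: cid; have [c [-> _]] := be (F i); exists c.
exists (\matrix_(i, j) sval (c i) 0 j) => i; rewrite {1}(svalP (c i)).
by apply: eq_bigr => j _; rewrite mxE.
Qed.

Lemma basis_mulmx e (F G : 'I_n -> tangent p) (A B : 'M[R]_n) :
  (forall i, F i = \sum_j A i j *: G j) -> (forall i, G i = \sum_j B i j *: e j) ->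
  forall i, F i = \sum_j (A *m B) i j *: e j.
Proof.
move=> FA GB i; rewrite FA.
under eq_bigr do rewrite GB scaler_sumr.
rewrite exchange_big; apply: eq_bigr => j _; rewrite mxE scaler_suml.
by apply: eq_bigr => k _; rewrite scalerA.
Qed.

Lemma basis_mx_inj e (F : 'I_n -> tangent p) (A B : 'M[R]_n) : is_basis e ->
  (forall i, F i = \sum_j A i j *: e j) -> (forall i, F i = \sum_j B i j *: e j) -> A = B.
Proof.
move=> be FA FB; apply/row_matrixP => i; apply: (basis_free be).
under eq_bigr do rewrite mxE; rewrite -FA FB.
by apply: eq_bigr => j _; rewrite mxE.
Qed.

Lemma endo_mx_conj e e' L (A B : 'M[R]_n) : is_basis e -> is_basis e' -> linear L ->
  (forall i, L (e i) = \sum_j A i j *: e j) -> (forall i, L (e' i) = \sum_j B i j *: e' j) ->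
  exists P Q : 'M[R]_n, [/\ P *m Q = 1%:M, Q *m P = 1%:M & A = P *m B *m Q].
Proof.
move=> be be' linL LA LB.
have [P eP] := basis_mx e be'; have [Q eQ] := basis_mx e' be.
have PQ : P *m Q = 1%:M.
  apply: (basis_mx_inj be (basis_mulmx eP eQ)) => i.
  rewrite (bigD1 i)//= big1 ?addr0 ?mxE ?eqxx ?scale1r// => j ji.
  by rewrite mxE eq_sym (negbTE ji) scale0r.
have QP : Q *m P = 1%:M by exact: mulmx1C.
exists P, Q; split=> //.
have Lsum (c : 'I_n -> R) F : L (\sum_i c i *: F i) = \sum_i c i *: L (F i).
  have L0 : L 0 = 0 by have := linL (-1) 0 0; rewrite !scaleN1r oppr0 addr0 addNr.
  apply: (big_ind2 (fun u v => L u = v)) => // [u _ v _ <- <-|i _].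
    by have := linL 1 u v; rewrite !scale1r.
  by rewrite -[c i *: F i]addr0 linL L0 addr0.
apply: (basis_mx_inj be LA).
apply: basis_mulmx eQ; apply: basis_mulmx LB => i.
by rewrite {1}eP Lsum.
Qed.

Lemma char_poly_conj (P Q B : 'M[R]_n) : P *m Q = 1%:M ->
  char_poly (P *m B *m Q) = char_poly B.
Proof.
move=> PQ; rewrite /char_poly /char_poly_mx.
have PQ1 : map_mx polyC P *m map_mx polyC Q = 1%:M by rewrite -map_mxM PQ map_mx1.
have -> : 'X%:M - map_mx polyC (P *m B *m Q) =
   map_mx polyC P *m ('X%:M - map_mx polyC B) *m map_mx polyC Q.
  by rewrite mulmxBr mulmxBl scalar_mxC -(mulmxA 'X%:M) PQ1 mulmx1 !map_mxM.
by rewrite !det_mulmx mulrAC -det_mulmx PQ1 det1 mul1r.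
Qed.

Lemma mx_of_endoP e L (A : 'M[R]_n) : is_basis e -> linear L ->
  (forall i, L (e i) = \sum_j A i j *: e j) ->
  trace L = \tr A /\ char_poly (mx_of_endo L) = char_poly A.
Proof.
move=> be linL LA.
have [e' be' LB] : [set B : 'M[R]_n | exists2 e : 'I_n -> tangent p, is_basis e &
    forall i, L (e i) = \sum_j B i j *: e j] (mx_of_endo L).
  by rewrite /mx_of_endo; apply: xgetPex; exists A; exists e.
have [P [Q [PQ QP AE]]] := endo_mx_conj be be' linL LA LB.
rewrite AE char_poly_conj//; split=> //.
by rewrite /trace mxtrace_mulC mulmxA QP mul1mx.
Qed.

End Bases.

Record algebraic_curvature (R : realFieldType) (E : lmodType R)
    (K : E -> E -> E -> E -> R) : Prop := AlgebraicCurvature {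
  alg_curv_linear : forall x y z c w w',
    K x y z (c *: w + w') = c * K x y z w + K x y z w' ;
  alg_curv_skewl : forall x y z w, K y x z w = - K x y z w ;
  alg_curv_skewr : forall x y z w, K x y w z = - K x y z w ;
  alg_curv_bianchi : forall x y z w, K x y z w + K y z x w + K z x y w = 0
}.

Lemma alg_curv_pair (R : realFieldType) (E : lmodType R) (K : E -> E -> E -> E -> R) :
  algebraic_curvature K -> forall x y z w, K x y z w = K z w x y.
Proof.
move=> KP x y z w; apply: (@pair_symmetry _ _ (fun=> True) K) => // *.
- exact: (alg_curv_skewl KP).
- exact: (alg_curv_skewr KP).
- exact: (alg_curv_bianchi KP).
Qed.

Lemma alg_curvZ (R : realFieldType) (E : lmodType R) (K : E -> E -> E -> E -> R) :
  algebraic_curvature K -> forall x y z c w, K x y z (c *: w) = c * K x y z w.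
Proof.
move=> KP x y z c w.
have K00 : K x y z 0 = 0.
  by have := alg_curv_linear KP x y z (-1) 0 0; rewrite scaleN1r oppr0 addr0 mulN1r addNr.
by rewrite -[c *: w]addr0 (alg_curv_linear KP) K00 addr0.
Qed.

Lemma big_ord5 (T : Type) (idx : T) (op : Monoid.law idx) (F : 'I_5 -> T) :
  \big[op/idx]_i F i = op (op (op (op (F 0) (F 1)) (F 2)) (F 3)) (F 4).
Proof.
rewrite !big_ord_recl big_ord0 Monoid.mulm1 !Monoid.mulmA.
by do ![congr (op _ _)]; congr F; apply: val_inj.
Qed.

Lemma ord5_ind (P : 'I_5 -> Prop) : P 0 -> P 1 -> P 2 -> P 3 -> P 4 -> forall i, P i.
Proof.
move=> P0 P1 P2 P3 P4 i.
have : i \in [:: 0; 1; 2; 3; 4] by case: i => [[|[|[|[|[|//]]]]] ?].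
by rewrite !inE => /or4P[/eqP ->|/eqP ->|/eqP ->|/orP[/eqP ->|/eqP ->]].
Qed.

Lemma dual_indexE : ((dual_index 0 = 0) * (dual_index 1 = 3) * (dual_index 2 = 4) *
  (dual_index 3 = 1) * (dual_index 4 = 2))%type.
Proof. by do !split; apply: val_inj. Qed.

Lemma dual_index_inj : injective dual_index.
Proof.
by case=> [[|[|[|[|[|//]]]]] ?] [[|[|[|[|[|//]]]]] ?] //= H; apply: val_inj; move/(congr1 val): H.
Qed.

Section NullFrame.
Context (R : realType) (M : manifold R 5) (g : bilinear_field M).
Hypothesis gP : pseudo_riemannian g.
Context (p : M) (e : 'I_5 -> tangent p).
Hypothesis e_basis : is_basis e.
Hypothesis e_gram : forall i j, g (e i) (e j) = (j == dual_index i)%:R.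

Lemma frame_expand v : v = \sum_i g v (e (dual_index i)) *: e i.
Proof.
have [c [vc _]] := e_basis v; rewrite {1}vc; apply: eq_bigr => i _; congr (_ *: _).
rewrite vc (g_suml gP) (bigD1 i)//= big1 ?addr0 => [|j ji].
  by rewrite (gZl gP) e_gram eqxx mulr1.
rewrite (gZl gP) e_gram (_ : _ == _ = false) ?mulr0//.
by apply: contra_neqF ji => /eqP /dual_index_inj ->.
Qed.

Lemma frame_expand5 v : v = g v (e 0) *: e 0 + g v (e 3) *: e 1 + g v (e 4) *: e 2
  + g v (e 1) *: e 3 + g v (e 2) *: e 4.
Proof. by rewrite {1}(frame_expand v) big_ord5 /= !dual_indexE. Qed.

Lemma gramE :
  ((g (e 0) (e 0) = 1) * (g (e 0) (e 1) = 0) * (g (e 0) (e 2) = 0) *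
   (g (e 0) (e 3) = 0) * (g (e 0) (e 4) = 0) *
   ((g (e 1) (e 0) = 0) * (g (e 1) (e 1) = 0) * (g (e 1) (e 2) = 0) *
   (g (e 1) (e 3) = 1) * (g (e 1) (e 4) = 0)) *
   ((g (e 2) (e 0) = 0) * (g (e 2) (e 1) = 0) * (g (e 2) (e 2) = 0) *
   (g (e 2) (e 3) = 0) * (g (e 2) (e 4) = 1)) *
   ((g (e 3) (e 0) = 0) * (g (e 3) (e 1) = 1) * (g (e 3) (e 2) = 0) *
   (g (e 3) (e 3) = 0) * (g (e 3) (e 4) = 0)) *
   ((g (e 4) (e 0) = 0) * (g (e 4) (e 1) = 0) * (g (e 4) (e 2) = 1) *
   (g (e 4) (e 3) = 0) * (g (e 4) (e 4) = 0)))%type.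
Proof. by do !split; rewrite e_gram. Qed.

Lemma sharpE (B : tangent p -> tangent p -> R) x v : (forall y, g v y = B x y) ->
  sharp g B x = v.
Proof.
move=> vB; apply: (g_eq gP) => y; rewrite vB.
have : [set v | forall y, g v y = B x y] (sharp g B x).
  by rewrite /sharp; apply: xgetPex; exists v.
exact.
Qed.

Lemma sharp_frame (B : tangent p -> tangent p -> R) :
  (forall c x x' y, B (c *: x + x') y = c * B x y + B x' y) ->
  (forall c x y y', B x (c *: y + y') = c * B x y + B x y') ->
  trace_g g B = \sum_i B (e i) (e (dual_index i)) /\
  char_poly (mx_of_endo (sharp g B)) = char_poly (\matrix_(i, j) B (e i) (e (dual_index j))).
Proof.
move=> Bl Br.
have B0 x : B x 0 = 0.
  by have := Br (-1) x 0 0; rewrite scaleN1r oppr0 addr0 mulN1r addNr.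
have BZ c x y : B x (c *: y) = c * B x y by rewrite -[c *: y]addr0 Br B0 addr0.
have sB x : sharp g B x = \sum_j B x (e (dual_index j)) *: e j.
  apply: sharpE => y; rewrite (g_suml gP) [in RHS](frame_expand5 y) -!addrA !Br BZ.
  rewrite big_ord5 /= !(gZl gP) !dual_indexE !(Defs.metric_sym gP (e _) y); ring.
have linS : linear (sharp g B).
  move=> c x y; rewrite !sB scaler_sumr -big_split; apply: eq_bigr => i _ /=.
  by rewrite Bl scalerDl scalerA.
have [|tr cp] := mx_of_endoP (A := \matrix_(i, j) B (e i) (e (dual_index j))) e_basis linS.
  by move=> i; rewrite sB; apply: eq_bigr => j _; rewrite mxE.
by split=> //; rewrite /trace_g tr; apply: eq_bigr => i _; rewrite mxE.
Qed.

Section AlgebraicCurvature.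
Context (K : tangent p -> tangent p -> tangent p -> tangent p -> R).
Hypothesis KP : algebraic_curvature K.
Hypothesis K0 : forall x y w, K x y (e 0) w = 0.
Hypothesis K1 : forall x y w, K x y (e 1) w = K x y (e 1) (e 3) * g (e 1) w.
Hypothesis K2 : forall x y w, K x y (e 2) w = K x y (e 2) (e 4) * g (e 2) w.

Let Klin := alg_curv_linear KP.
Let Kskewl := alg_curv_skewl KP.
Let Kskewr := alg_curv_skewr KP.
Let Kbianchi := alg_curv_bianchi KP.
Let Kpair := alg_curv_pair KP.

Let t x i := g x (e i).
Let T i j x y := t x i * t y j - t y i * t x j.

Lemma Kexpand x y z w : K x y z w =
  t w 0 * K x y z (e 0) + t w 3 * K x y z (e 1) + t w 4 * K x y z (e 2)
  + t w 1 * K x y z (e 3) + t w 2 * K x y z (e 4).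
Proof.
by rewrite {1}(frame_expand5 w) -!addrA !Klin (alg_curvZ KP) !addrA.
Qed.

Lemma Kdecomp x y z w : K x y z w = K x y (e 3) (e 4) * T 1 2 z w
  - K x y (e 1) (e 3) * T 1 3 z w - K x y (e 2) (e 4) * T 2 4 z w.
Proof.
have Kr0 u : K x y u (e 0) = 0 by rewrite Kskewr K0 oppr0.
have Kr1 u : K x y u (e 1) = - K x y (e 1) (e 3) * g (e 1) u.
  by rewrite Kskewr K1 mulNr.
have Kr2 u : K x y u (e 2) = - K x y (e 2) (e 4) * g (e 2) u.
  by rewrite Kskewr K2 mulNr.
have K33 : K x y (e 3) (e 3) = 0 by have := Kskewr x y (e 3) (e 3); lra.
have K44 : K x y (e 4) (e 4) = 0 by have := Kskewr x y (e 4) (e 4); lra.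
have K43 : K x y (e 4) (e 3) = - K x y (e 3) (e 4) by exact: Kskewr.
have Kr3 u : K x y u (e 3) = t u 3 * K x y (e 1) (e 3) - t u 2 * K x y (e 3) (e 4).
  rewrite Kskewr Kexpand Kr0 Kr1 Kr2 K33 !gramE /t; ring.
have Kr4 u : K x y u (e 4) = t u 4 * K x y (e 2) (e 4) + t u 1 * K x y (e 3) (e 4).
  rewrite Kskewr Kexpand Kr0 Kr1 Kr2 K44 !gramE K43 /t; ring.
rewrite Kexpand Kr0 Kr1 Kr2 (Kr3 z) (Kr4 z) /T /t !(Defs.metric_sym gP (e _) z); ring.
Qed.

Let a1 := K (e 3) (e 4) (e 1) (e 3).
Let a2 := K (e 3) (e 1) (e 1) (e 3).
Let b1 := K (e 3) (e 4) (e 2) (e 4).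
Let b2 := K (e 4) (e 2) (e 2) (e 4).
Let c := K (e 3) (e 4) (e 3) (e 4).

(* The two other terms of the cyclic sum vanish: [K1] and pair symmetry. *)
Let K1324 : K (e 1) (e 3) (e 2) (e 4) = 0.
Proof.
have := Kbianchi (e 1) (e 3) (e 2) (e 4).
by rewrite (Kpair (e 2) (e 1)) (K2 _ _ (e 1)) (K1 _ (e 2)) !gramE !mulr0 !addr0.
Qed.

Lemma K_13 x y : K x y (e 1) (e 3) = a1 * T 1 2 x y + a2 * T 1 3 x y.
Proof.
rewrite Kpair Kdecomp K1324 (Kpair _ _ (e 3)) -/a1 (Kskewl (e 3)) -/a2; ring.
Qed.

Lemma K_24 x y : K x y (e 2) (e 4) = b1 * T 1 2 x y + b2 * T 2 4 x y.
Proof.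
rewrite Kpair Kdecomp (Kpair _ _ (e 1)) K1324 (Kpair _ _ (e 3)) -/b1 (Kskewl (e 4)) -/b2; ring.
Qed.

Lemma K_34 x y : K x y (e 3) (e 4) = c * T 1 2 x y - a1 * T 1 3 x y - b1 * T 2 4 x y.
Proof. by rewrite Kpair Kdecomp. Qed.

Lemma Kfull x y z w : K x y z w = c * (T 1 2 x y * T 1 2 z w)
  - a2 * (T 1 3 x y * T 1 3 z w) - b2 * (T 2 4 x y * T 2 4 z w)
  - (a1 * (T 1 2 x y * T 1 3 z w + T 1 2 z w * T 1 3 x y)
     + b1 * (T 1 2 x y * T 2 4 z w + T 1 2 z w * T 2 4 x y)).
Proof. rewrite Kdecomp K_13 K_24 K_34; ring. Qed.

Lemma Kricci x y : \sum_i K (e i) x y (e (dual_index i)) =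
  - a2 * (t x 1 * t y 3 + t y 1 * t x 3) - b2 * (t x 2 * t y 4 + t y 2 * t x 4)
  - (a1 - b1) * (t x 1 * t y 2 + t y 1 * t x 2).
Proof.
by rewrite big_ord5 /= !Kfull /T /t !dual_indexE !gramE; ring.
Qed.

End AlgebraicCurvature.
End NullFrame.

(** * Adopted frames *)

Section AdoptedGeometry.
Context (R : realType) (M : manifold R 5).
Context (phi : endo_field M) (xi : vfield M) (eta : oneform M) (g : bilinear_field M).
Context (nabla : vfield M -> vfield M -> vfield M).
Hypothesis apc : almost_paracontact_metric (n := 2) phi xi eta g.
Hypothesis lc : levi_civita g nabla.
Context (sigma : R) (U : set M) (V : 'I_5 -> vfield M).
Hypothesis adopted : adopted_frame phi xi g nabla sigma U V.
Implicit Types (p q : M) (W : set M) (X Y Z T : vfield M).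

Let gP : pseudo_riemannian g := apc_metric apc.
Let oU : open U := frame_open adopted.
Let sV i : smooth_vfield U (V i) := frame_smooth adopted i.

Let expandU p v : U p -> v = \sum_i g v (V (dual_index i) p) *: V i p.
Proof.
move=> Up; exact: (frame_expand gP (frame_basis adopted Up) (frame_gram adopted Up)).
Qed.

Lemma smooth_near_sub p X : U p -> smooth_near p X ->
  exists W, [/\ open W, W p, W `<=` U & smooth_vfield W X].
Proof.
move=> Up [W [oW Wp sX]]; exists (W `&` U); split=> //; first exact: openI.
by apply: smooth_vfield_sub sX => q [].
Qed.

Lemma smooth_nearU p X : U p -> smooth_vfield U X -> smooth_near p X.
Proof. by exists U. Qed.

Lemma nabla_frame p X Y : U p -> smooth_near p X -> smooth_near p Y ->
  nabla X Y p = \sum_i g (X p) (V (dual_index i) p) *: nabla (V i) Y p.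
Proof.
move=> Up nX nY.
have [W [oW Wp [sX sY sV0 _]]] := smooth_near_common nX nY (smooth_nearU Up (sV 0)) nX.
pose B := W `&` U; have oB : open B by exact: openI.
have BW : B `<=` W by move=> q [].
have BU : B `<=` U by move=> q [].
have sVB i := smooth_vfield_sub BU (sV i).
have {}sX := smooth_vfield_sub BW sX; have {}sY := smooth_vfield_sub BW sY.
have Bp : B p by [].
have sf i : smooth_on B (fun q => g (X q) (V (dual_index i) q)).
  exact: (metric_smooth gP).
have [s1 <-] := nabla_suml lc (index_enum 'I_5) oB Bp sf sVB sY.
by apply: (nabla_local lc oB Bp) => // q /BU Uq; exact: expandU.
Qed.

Lemma nabla_pointwise p X X' Y : U p -> smooth_near p X -> smooth_near p X' ->
  smooth_near p Y -> X p = X' p -> nabla X Y p = nabla X' Y p.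
Proof. by move=> Up nX nX' nY XX'; rewrite !nabla_frame// XX'. Qed.

Lemma extension_near p (x : tangent p) : U p ->
  smooth_near p (extension x) /\ extension x p = x.
Proof.
move=> Up; rewrite /extension.
apply: (@xgetPex _ _ [set X : vfield M | smooth_near p X /\ X p = x]).
exists (fun q => \sum_i g x (V (dual_index i) p) *: V i q); split; last first.
  by rewrite -expandU.
exists U; split=> //.
by have [] := nabla_suml lc (index_enum 'I_5) oU Up
  (fun i => smooth_on_cst (g x (V (dual_index i) p)) oU) sV (sV 0).
Qed.

Let ext_near p (x : tangent p) (Up : U p) := proj1 (extension_near x Up).
Let ext_val p (x : tangent p) (Up : U p) := proj2 (extension_near x Up).

Lemma covdE p X Y : U p -> smooth_near p X -> smooth_near p Y ->
  covd nabla (X p) Y = nabla X Y p.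
Proof.
by move=> Up nX nY; apply: nabla_pointwise => //; [exact: ext_near|exact: ext_val].
Qed.

Lemma riemannE p X Y Z : U p -> smooth_near p X -> smooth_near p Y -> smooth_near p Z ->
  riemann nabla (X p) (Y p) (Z p) = curvature nabla X Y Z p.
Proof.
move=> Up nX nY nZ; apply: (g_eq gP) => w.
rewrite -(ext_val w Up) /riemann.
by apply: (curvature_pointwise gP lc); rewrite ?ext_val//; exact: ext_near.
Qed.

Lemma riemann4_algebraic p : U p ->
  algebraic_curvature (fun x y z w : tangent p => riemann4 g nabla x y z w).
Proof.
move=> Up.
have common (x y z w : tangent p) := smooth_near_common
  (ext_near x Up) (ext_near y Up) (ext_near z Up) (ext_near w Up).
split=> [x y z c w w'|x y z w|x y z w|x y z w].
- by rewrite /riemann4 (gDr gP) (gZr gP).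
- have [W [oW Wp [sx sy sz sw]]] := common x y z w.
  by rewrite /riemann4 /riemann (curvature_skewl lc oW Wp sx sy sz) (gNl gP).
- have [W [oW Wp [sx sy sz sw]]] := common x y z w.
  by have := curvature_skewr gP lc oW Wp sx sy sz sw; rewrite !ext_val.
- have [W [oW Wp [sx sy sz sw]]] := common x y z w.
  rewrite /riemann4 /riemann -!(gDl gP) (bianchi_identity lc oW Wp sx sy sz).
  exact: (g0l gP).
Qed.

(* [Z'] only serves to see that the functions [a(Y)] are smooth. *)
Lemma recurrent_curvature Z Z' (a : oneform M) p (x y : tangent p) : U p ->
  smooth_vfield U Z -> smooth_vfield U Z' -> (forall q, U q -> g (Z q) (Z' q) = 1) ->
  (forall q, U q -> forall v : tangent q, covd nabla v Z = a q v *: Z q) ->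
  riemann nabla x y (Z p) = (2 * ext_d1 a x y) *: Z p.
Proof.
move=> Up sZ sZ' ZZ' aZ.
have nx := ext_near x Up; have ny := ext_near y Up.
have [A [oA Ap [sX sY _ _]]] := smooth_near_common nx ny nx ny.
pose W := A `&` U; have oW : open W by exact: openI.
have Wp : W p by [].
have WA : W `<=` A by move=> q [].
have WU : W `<=` U by move=> q [].
have {}sX := smooth_vfield_sub WA sX; have {}sY := smooth_vfield_sub WA sY.
have {}sZ := smooth_vfield_sub WU sZ; have {}sZ' := smooth_vfield_sub WU sZ'.
have near B q : W q -> smooth_vfield W B -> smooth_near q B by move=> Wq sB; exists W.
have nab B q : W q -> smooth_vfield W B -> nabla B Z q = a q (B q) *: Z q.
  by move=> Wq sB; rewrite -aZ ?covdE//; [exact: WU|exact: near|exact: near|exact: WU].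
have sa B : smooth_vfield W B -> smooth_on W (fun q => a q (B q)).
  move=> sB; apply: smooth_on_ext (metric_smooth gP oW (nabla_smooth lc oW sB sZ) sZ') => //.
  by move=> q Wq; rewrite nab// (gZl gP) ZZ' ?mulr1//; exact: WU.
have second B C : smooth_vfield W B -> smooth_vfield W C ->
    nabla B (nabla C Z) p = (a p (C p) * a p (B p) + vaction B (fun q => a q (C q)) p) *: Z p.
  move=> sB sC; rewrite scalerDl -scalerA -nab// -(nablaZr lc oW Wp (sa _ sC) sB sZ).
  by apply: (nabla_local lc oW Wp) => // [|q Wq]; [exact: (nabla_smooth lc)|exact: nab].
rewrite -{1}(ext_val x Up) -{1}(ext_val y Up) riemannE//; last exact: near.
rewrite /curvature !second// nab//; last exact: smooth_bracket.
rewrite -!scalerBl; congr (_ *: _).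
by rewrite /ext_d1 mulrA divff ?pnatr_eq0// mul1r; ring.
Qed.

Lemma phi_xi p : phi (xi p) = 0.
Proof.
have phi0 := endo0 p (apc_phi_smooth apc).
have xi2 : phi (phi (xi p)) = 0.
  by rewrite (apc_phi2 apc) (apc_eta_xi apc) scale1r subrr.
have := apc_phi2 apc (phi (xi p)); rewrite xi2 phi0 => /esym/eqP.
rewrite subr_eq0 => /eqP E.
have c0 : eta (phi (xi p)) = 0.
  move: xi2; rewrite E (endoZ _ _ (apc_phi_smooth apc)) E scalerA => /(congr1 (@eta p)) .
  have [etal _] := apc_eta_smooth apc.
  have eta0 : eta (0 : tangent p) = 0.
    by have := etal p (-1) 0 0; rewrite !scaleN1r oppr0 addr0 mulN1r addNr.
  have etaZ c : eta (c *: xi p) = c.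
    by rewrite -[c *: xi p]addr0 etal eta0 (apc_eta_xi apc) mulr1 addr0.
  rewrite !etaZ eta0 => /eqP; rewrite mulf_eq0 orbb => /eqP //.
by rewrite E c0 scale0r.
Qed.

(* As [phi xi = 0], the vector [R(x, y)xi] lies in the kernel of [phi], which is
   spanned by [xi], while it is orthogonal to [xi] by skew-symmetry. *)
Lemma riemann_xi p (x y : tangent p) : U p ->
  (forall z : tangent p, riemann nabla x y (phi z) = phi (riemann nabla x y z)) ->
  riemann nabla x y (xi p) = 0.
Proof.
move=> Up comm.
have R0 : riemann nabla x y 0 = 0.
  apply: (g_eq gP) => w; rewrite [LHS](alg_curv_skewr (riemann4_algebraic Up) x y w 0) (g0l gP).
  by rewrite /riemann4 (Defs.metric_sym gP) (g0l gP) oppr0.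
have phi0 := endo0 p (apc_phi_smooth apc).
have := apc_phi2 apc (riemann nabla x y (xi p)).
rewrite -comm phi_xi R0 phi0 => /esym/eqP; rewrite subr_eq0 => /eqP ->.
rewrite (apc_eta_dual apc) (Defs.metric_sym gP).
have := alg_curv_skewr (riemann4_algebraic Up) x y (xi p) (xi p); rewrite /riemann4 => H.
rewrite (_ : g _ _ = 0) ?scale0r//.
by move: H; set u := g _ _ => H; lra.
Qed.

Lemma frame_nabla_skew p X i j : U p -> smooth_near p X ->
  g (nabla X (V i) p) (V j p) = - g (nabla X (V j) p) (V i p).
Proof.
move=> Up nX; have [W [oW Wp WU sX]] := smooth_near_sub Up nX.
have sW k := smooth_vfield_sub WU (sV k).
have := metric_compat lc oW Wp sX (sW i) (sW j).
rewrite (@vaction_local _ _ _ W X _ (fun=> (j == dual_index i)%:R))//; last first.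
  by move=> q /WU Uq; exact: (frame_gram adopted).
rewrite vaction_cst (Defs.metric_sym gP (V i p)) => /esym/eqP.
by rewrite addr_eq0 => /eqP.
Qed.

Lemma nabla_xi p X : U p -> smooth_near p X ->
  nabla X (V 0) p = - (g (X p) (V 1 p) *: V 1 p + (sigma * g (X p) (V 2 p)) *: V 2 p).
Proof.
move=> Up nX; have [W [oW Wp WU sX]] := smooth_near_sub Up nX.
rewrite -(char_shape (frame_char adopted) Up) /shape opprK covdE//.
  apply: (nabla_local lc oW Wp) => // [|q /WU]; last exact: (frame_xi adopted).
  exact: smooth_vfield_sub (sV 0).
exists setT; split=> //; [exact: openT|exact: (apc_xi_smooth apc)].
Qed.

Context (tau1 tau2 omega : oneform M).
Hypothesis conn : connection_forms g nabla U V tau1 tau2 omega.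

Let gram p (Up : U p) := gramE (frame_gram adopted Up).

Lemma riemann_V1 p (x y : tangent p) : U p ->
  riemann nabla x y (V 1 p) = (2 * ext_d1 tau1 x y) *: V 1 p.
Proof.
move=> Up; apply: (recurrent_curvature x y Up (sV 1) (sV 3)) => q Uq.
  by rewrite (gram Uq).
exact: (conn_tau1 conn).
Qed.

Lemma riemann_V2 p (x y : tangent p) : U p ->
  riemann nabla x y (V 2 p) = (2 * ext_d1 tau2 x y) *: V 2 p.
Proof.
move=> Up; apply: (recurrent_curvature x y Up (sV 2) (sV 4)) => q Uq.
  by rewrite (gram Uq).
exact: (conn_tau2 conn).
Qed.

Lemma riemann_V34 p (x y : tangent p) : U p ->
  riemann4 g nabla x y (V 3 p) (V 4 p) =
  2 * Domega tau1 tau2 omega x y + sigma * Theta g V 1 2 x y.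
Proof.
move=> Up.
have nx := ext_near x Up; have ny := ext_near y Up.
have [A [oA Ap [sX sY _ _]]] := smooth_near_common nx ny nx ny.
pose W := A `&` U; have oW : open W by exact: openI.
have Wp : W p by [].
have WA : W `<=` A by move=> q [].
have WU : W `<=` U by move=> q [].
have {}sX := smooth_vfield_sub WA sX; have {}sY := smooth_vfield_sub WA sY.
have sVW i := smooth_vfield_sub WU (sV i).
have near B q : W q -> smooth_vfield W B -> smooth_near q B by move=> Wq sB; exists W.
have om B q : W q -> smooth_vfield W B -> g (nabla B (V 3) q) (V 4 q) = omega (B q).
  move=> Wq sB; rewrite (conn_omega conn) ?covdE//; try exact: near; exact: WU.
have t1 B : smooth_vfield W B -> nabla B (V 1) p = tau1 (B p) *: V 1 p.
  by move=> sB; rewrite -(conn_tau1 conn)// covdE//; exact: near.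
have t2 B : smooth_vfield W B -> nabla B (V 2) p = tau2 (B p) *: V 2 p.
  by move=> sB; rewrite -(conn_tau2 conn)// covdE//; exact: near.
have second B C : smooth_vfield W B -> smooth_vfield W C ->
    g (nabla B (nabla C (V 3)) p) (V 4 p) = vaction B (fun q => omega (C q)) p
    - (sigma * g (C p) (V 1 p) * g (B p) (V 2 p) - omega (C p) * tau2 (B p)
       + tau1 (C p) * omega (B p)).
  move=> sB sC; have sC3 := nabla_smooth lc oW sC (sVW 3).
  have := metric_compat lc oW Wp sB sC3 (sVW 4).
  rewrite (@vaction_local _ _ _ W B _ (fun q => omega (C q)))//; last first.
    by move=> q Wq; exact: om.
  have e5 := frame_expand5 gP (frame_basis adopted Up) (frame_gram adopted Up).
  move=> ->; rewrite [X in g X (nabla B _ _)]e5.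
  have nB := near _ _ Wp sB; have nC := near _ _ Wp sC.
  have skB i j := frame_nabla_skew i j Up nB; have skC i j := frame_nabla_skew i j Up nC.
  have self D i : smooth_near p D -> g (nabla D (V i) p) (V i p) = 0.
    by move=> nD; have := frame_nabla_skew i i Up nD; lra.
  rewrite !(gDl gP) !(gZl gP) !(Defs.metric_sym gP _ (nabla B (V 4) p)).
  rewrite !self// (skC 3 0) (skB 4 0) (skC 3 1) (skC 3 2) (skB 4 1) (skB 4 2) (skB 4 3).
  rewrite !om// !t1// !t2// !nabla_xi//.
  rewrite !(gNl gP) !(gDl gP) !(gZl gP) !(gram Up); ring.
rewrite /riemann4 -{1}(ext_val x Up) -{1}(ext_val y Up) riemannE//; last exact: near.
rewrite /curvature !(gBl gP) !second// om//; last exact: smooth_bracket.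
rewrite /Domega /Theta /wedge /coframe /ext_d1 !ext_val//; by field.
Qed.

Hypothesis phi_curvature : forall p (x y z : tangent p),
  riemann nabla x y (phi z) = phi (riemann nabla x y z).

Definition frame_curvature i j k l p :=
  riemann4 g nabla (V i p) (V j p) (V k p) (V l p).

Lemma frame_curvature_smooth i j k l : smooth_on U (frame_curvature i j k l).
Proof.
apply: smooth_on_ext
  (metric_smooth gP oU (curvature_smooth lc oU (sV i) (sV j) (sV k)) (sV l)) => // p Up.
by rewrite /frame_curvature /riemann4 riemannE//; exact: smooth_nearU.
Qed.

Section Pointwise.
Context (p : M) (Up : U p).
Let K (x y z w : tangent p) := riemann4 g nabla x y z w.
Let C i j k l := frame_curvature i j k l p.

Let K0 x y w : K x y (V 0 p) w = 0.
Proof.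
by rewrite (frame_xi adopted Up) /K /riemann4 riemann_xi// (g0l gP).
Qed.

Let K1 x y w : K x y (V 1 p) w = K x y (V 1 p) (V 3 p) * g (V 1 p) w.
Proof. by rewrite /K /riemann4 riemann_V1// !(gZl gP) (gram Up) mulr1. Qed.

Let K2 x y w : K x y (V 2 p) w = K x y (V 2 p) (V 4 p) * g (V 2 p) w.
Proof. by rewrite /K /riemann4 riemann_V2// !(gZl gP) (gram Up) mulr1. Qed.

Let KP := riemann4_algebraic Up.

Lemma riemann4_lin1 c x x' y z w : K (c *: x + x') y z w = c * K x y z w + K x' y z w.
Proof.
rewrite /K [LHS](alg_curv_pair KP) (alg_curv_pair KP x) (alg_curv_pair KP x').
rewrite [LHS](alg_curv_skewr KP) (alg_curv_linear KP).
rewrite (alg_curv_skewr KP z w y x) (alg_curv_skewr KP z w y x'); ring.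
Qed.

Lemma riemann_lin1 y z : linear (fun x : tangent p => riemann nabla x y z).
Proof.
move=> c x x'; apply: (g_eq gP) => w.
by rewrite [RHS](gDl gP) [X in _ = X + _](gZl gP); exact: riemann4_lin1.
Qed.

Let half_double (u v : R) : 2 * u = v -> u = 2^-1 * v.
Proof. by move=> <-; rewrite mulrA mulVf ?mul1r// pnatr_eq0. Qed.

Lemma dtau1E (x y : tangent p) : ext_d1 tau1 x y =
  C 3 4 1 3 * wedge (coframe g V 1) (coframe g V 2) x y
  + C 3 1 1 3 * wedge (coframe g V 1) (coframe g V 3) x y.
Proof.
have := K_13 gP (frame_basis adopted Up) (frame_gram adopted Up) KP K0 K1 K2 x y.
rewrite {1}/riemann4 riemann_V1// (gZl gP) (gram Up) mulr1 => /half_double ->.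
rewrite /wedge /coframe /C /frame_curvature; ring.
Qed.

Lemma dtau2E (x y : tangent p) : ext_d1 tau2 x y =
  C 3 4 2 4 * wedge (coframe g V 1) (coframe g V 2) x y
  + C 4 2 2 4 * wedge (coframe g V 2) (coframe g V 4) x y.
Proof.
have := K_24 gP (frame_basis adopted Up) (frame_gram adopted Up) KP K0 K1 K2 x y.
rewrite {1}/riemann4 riemann_V2// (gZl gP) (gram Up) mulr1 => /half_double ->.
rewrite /wedge /coframe /C /frame_curvature; ring.
Qed.

Lemma DomegaE (x y : tangent p) : Domega tau1 tau2 omega x y =
  (C 3 4 3 4 - sigma) * wedge (coframe g V 1) (coframe g V 2) x y
  - C 3 4 1 3 * wedge (coframe g V 1) (coframe g V 3) x y
  - C 3 4 2 4 * wedge (coframe g V 2) (coframe g V 4) x y.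
Proof.
have := K_34 gP (frame_basis adopted Up) (frame_gram adopted Up) KP K0 K1 K2 x y.
rewrite riemann_V34// => /(canRL (addrK _)) /half_double ->.
rewrite /Theta /wedge /coframe /C /frame_curvature; by field.
Qed.

Lemma riemann4E (x y z w : tangent p) : K x y z w =
  C 3 4 3 4 * prod2form (Theta g V 1 2) (Theta g V 1 2) x y z w
  - C 3 1 1 3 * prod2form (Theta g V 1 3) (Theta g V 1 3) x y z w
  - C 4 2 2 4 * prod2form (Theta g V 2 4) (Theta g V 2 4) x y z w
  - 2 * (C 3 4 1 3 * prod2form (Theta g V 1 2) (Theta g V 1 3) x y z w
         + C 3 4 2 4 * prod2form (Theta g V 1 2) (Theta g V 2 4) x y z w).
Proof.
rewrite [LHS](Kfull gP (frame_basis adopted Up) (frame_gram adopted Up) KP K0 K1 K2 x y z w).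
rewrite /prod2form /Theta /wedge /coframe /C /frame_curvature; by field.
Qed.

Lemma ricciE (x y : tangent p) : ricci nabla x y =
  - 2 * C 3 1 1 3 * symprod (coframe g V 1) (coframe g V 3) x y
  - 2 * C 4 2 2 4 * symprod (coframe g V 2) (coframe g V 4) x y
  - 2 * (C 3 4 1 3 - C 3 4 2 4) * symprod (coframe g V 1) (coframe g V 2) x y.
Proof.
pose A := \matrix_(i, j) K (V i p) x y (V (dual_index j) p).
have [|tr _] := mx_of_endoP (A := A) (frame_basis adopted Up) (riemann_lin1 x y).
  move=> i; rewrite [LHS](expandU _ Up); apply: eq_bigr => j _.
  by rewrite mxE.
rewrite /ricci tr /mxtrace; under eq_bigr do rewrite mxE.
rewrite (Kricci gP (frame_basis adopted Up) (frame_gram adopted Up) KP K0 K1 K2 x y).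
rewrite /symprod /coframe /C /frame_curvature; by field.
Qed.

Lemma ricci_trace_g (x y : tangent p) :
  ricci nabla x y = trace_g g (fun z w => riemann4 g nabla z x y w).
Proof.
rewrite /ricci /trace_g; congr trace; apply/funext => z.
by apply/esym; exact: (sharpE gP).
Qed.

Let ricci_sharp := sharp_frame gP (frame_basis adopted Up) (frame_gram adopted Up)
  (B := @ricci _ _ M nabla p).

Let ricci_linl c (x x' y : tangent p) :
  ricci nabla (c *: x + x') y = c * ricci nabla x y + ricci nabla x' y.
Proof. rewrite !ricciE /symprod /coframe !(gDl gP) !(gZl gP); ring. Qed.

Let ricci_linr c (x y y' : tangent p) :
  ricci nabla x (c *: y + y') = c * ricci nabla x y + ricci nabla x y'.
Proof. rewrite !ricciE /symprod /coframe !(gDl gP) !(gZl gP); ring. Qed.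

Lemma scalar_curvatureE :
  scalar_curvature g nabla p = - 2 * (C 3 1 1 3 + C 4 2 2 4).
Proof.
have [tr _] := ricci_sharp ricci_linl ricci_linr; rewrite /scalar_curvature tr.
by rewrite big_ord5 /= !ricciE /symprod /coframe !dual_indexE !(gram Up); field.
Qed.

Lemma ricci_char_poly : char_poly (mx_of_endo (sharp g (@ricci _ _ M nabla p)))
  = 'X * ('X - (- C 3 1 1 3)%:P) ^+ 2 * ('X - (- C 4 2 2 4)%:P) ^+ 2.
Proof.
have [_ ->] := ricci_sharp ricci_linl ricci_linr; rewrite char_poly_trig; last first.
  apply/is_trig_mxP; apply: ord5_ind; apply: ord5_ind => //= _;
    by rewrite mxE ricciE /symprod /coframe !dual_indexE !(gram Up); ring.
have diag i d : ricci nabla (V i p) (V (dual_index i) p) = d ->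
    'X - ((\matrix_(i, j) ricci nabla (V i p) (V (dual_index j) p)) i i)%:P = 'X - d%:P.
  by move=> <-; rewrite mxE.
rewrite big_ord5 /= (diag 0 (0)); last first.
  by rewrite ricciE /symprod /coframe !dual_indexE !(gram Up); ring.
rewrite (diag 1 (- C 3 1 1 3)); last first.
  by rewrite ricciE /symprod /coframe !dual_indexE !(gram Up); field.
rewrite (diag 2 (- C 4 2 2 4)); last first.
  by rewrite ricciE /symprod /coframe !dual_indexE !(gram Up); field.
rewrite (diag 3 (- C 3 1 1 3)); last first.
  by rewrite ricciE /symprod /coframe !dual_indexE !(gram Up); field.
rewrite (diag 4 (- C 4 2 2 4)); last first.
  by rewrite ricciE /symprod /coframe !dual_indexE !(gram Up); field.
rewrite subr0; ring.
Qed.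

End Pointwise.

End AdoptedGeometry.

(** * Change of adopted frame *)

Section FrameChange.
Context (R : realType) (M : manifold R 5).
Context (phi : endo_field M) (xi : vfield M) (eta : oneform M) (g : bilinear_field M).
Context (nabla : vfield M -> vfield M -> vfield M).
Hypothesis apc : almost_paracontact_metric (n := 2) phi xi eta g.
Hypothesis lc : levi_civita g nabla.
Context (sigma : R) (U U' : set M) (V V' : 'I_5 -> vfield M).
Hypothesis sigma_neq0 : sigma != 0.
Hypothesis adopted : adopted_frame phi xi g nabla sigma U V.
Hypothesis adopted' : adopted_frame phi xi g nabla sigma U' V'.
Context (tau1 tau2 omega tau1' tau2' omega' : oneform M).
Hypothesis conn : connection_forms g nabla U V tau1 tau2 omega.
Hypothesis conn' : connection_forms g nabla U' V' tau1' tau2' omega'.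
Context (p : M) (Up : U p) (U'p : U' p).

Let gP : pseudo_riemannian g := apc_metric apc.
Let gram := gramE (frame_gram adopted Up).
Let gram' := gramE (frame_gram adopted' U'p).

Lemma rank_one_eq (v v' w w' : tangent p) : g w v = 1 -> g w' v' = 1 ->
  (forall x, g x v *: v = g x v' *: v') -> exists2 c, c * c = 1 & v' = c *: v.
Proof.
move=> wv w'v' E.
have v'E : v' = g w' v *: v by rewrite E w'v' scale1r.
exists (g w' v) => //; have := congr1 (g w) (E w).
by rewrite v'E !(gZr gP) wv !mulr1.
Qed.

Lemma char_fields_unique :
  (exists2 c, c * c = 1 & V' 1 p = c *: V 1 p) /\
  (exists2 c, c * c = 1 & V' 2 p = c *: V 2 p).
Proof.
have [phil _] := apc_phi_smooth apc.
have F := frame_char adopted; have F' := frame_char adopted'.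
have E x : g x (V 1 p) *: V 1 p + (sigma * g x (V 2 p)) *: V 2 p =
           g x (V' 1 p) *: V' 1 p + (sigma * g x (V' 2 p)) *: V' 2 p.
  by rewrite -(char_shape F Up) (char_shape F' U'p).
have Ephi x : - (g x (V 1 p) *: V 1 p) + (sigma * g x (V 2 p)) *: V 2 p =
           - (g x (V' 1 p) *: V' 1 p) + (sigma * g x (V' 2 p)) *: V' 2 p.
  have := congr1 (@phi p) (E x); rewrite !phil !(endoZ _ _ (apc_phi_smooth apc)).
  by rewrite (char_phi1 F Up) (char_phi2 F Up) (char_phi1 F' U'p) (char_phi2 F' U'p) !scalerN.
have sum_diff (a b a' b' : tangent p) : a + b = a' + b' -> - a + b = - a' + b' ->
    a = a' /\ b = b'.
  move=> s d; have bb : b = b'.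
    apply: (@scalerI _ _ 2); first by rewrite pnatr_eq0.
    by have := congr2 +%R s d; rewrite addrACA subrr add0r addrACA subrr add0r !scaler_nat !mulr2n.
  by split=> //; move: s; rewrite bb => /addIr.
split.
  apply: (@rank_one_eq _ _ (V 3 p) (V' 3 p)); rewrite ?gram ?gram'// => x.
  by have [] := sum_diff _ _ _ _ (E x) (Ephi x).
apply: (@rank_one_eq _ _ (V 4 p) (V' 4 p)); rewrite ?gram ?gram'// => x.
apply: (scalerI sigma_neq0); rewrite !scalerA.
by have [] := sum_diff _ _ _ _ (E x) (Ephi x).
Qed.

Lemma riemann_scale (x y z : tangent p) c :
  riemann nabla x y (c *: z) = c *: riemann nabla x y z.
Proof.
have KP := riemann4_algebraic apc lc adopted Up.
apply: (g_eq gP) => w.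
by rewrite [LHS](alg_curv_skewr KP) (alg_curvZ KP) (gZl gP) -mulrN -(alg_curv_skewr KP).
Qed.

Lemma dtau_invariant (x y : tangent p) :
  ext_d1 tau1' x y = ext_d1 tau1 x y /\ ext_d1 tau2' x y = ext_d1 tau2 x y.
Proof.
have two (u v c : R) (z w : tangent p) : g z w = 1 ->
    (2 * u) *: z = (2 * v) *: z -> u = v.
  move=> zw /(congr1 (fun s => g s w)); rewrite !(gZl gP) zw !mulr1.
  by apply: mulfI; rewrite pnatr_eq0.
have [[c _ E1] [d _ E2]] := char_fields_unique.
split.
  apply: (two _ _ 0 (V' 1 p) (V' 3 p)); first by rewrite gram'.
  rewrite -(riemann_V1 apc lc adopted' conn')// E1 riemann_scale.
  by rewrite (riemann_V1 apc lc adopted conn)// !scalerA mulrC.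
apply: (two _ _ 0 (V' 2 p) (V' 4 p)); first by rewrite gram'.
rewrite -(riemann_V2 apc lc adopted' conn')// E2 riemann_scale.
by rewrite (riemann_V2 apc lc adopted conn)// !scalerA mulrC.
Qed.

Context (a1 a2 b1 b2 c a1' a2' b1' b2' c' : M -> R).
Hypothesis str : structure_equations g U V tau1 tau2 omega a1 a2 b1 b2 c.
Hypothesis str' : structure_equations g U' V' tau1' tau2' omega' a1' a2' b1' b2' c'.

Lemma structure_invariant : a2' p = a2 p /\ b2' p = b2 p.
Proof.
have [[e e1 E1] [d d1 E2]] := char_fields_unique.
have E1' : V 1 p = e *: V' 1 p by rewrite E1 scalerA e1 scale1r.
have E2' : V 2 p = d *: V' 2 p by rewrite E2 scalerA d1 scale1r.
split.
  have [+ _ _] := str Up (V' 3 p) (V' 1 p); have [+ _ _] := str' U'p (V' 3 p) (V' 1 p).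
  have [-> _] := dtau_invariant (V' 3 p) (V' 1 p).
  rewrite /wedge /coframe !gram' => -> .
  have -> : g (V' 3 p) (V 1 p) = e by rewrite E1' (gZr gP) gram' mulr1.
  have -> : g (V' 1 p) (V 2 p) = 0 by rewrite E1 (gZl gP) gram mulr0.
  have -> : g (V' 1 p) (V 1 p) = 0 by rewrite E1 (gZl gP) gram mulr0.
  have -> : g (V' 1 p) (V 3 p) = e by rewrite E1 (gZl gP) gram mulr1.
  rewrite e1 => H; lra.
have [_ + _] := str Up (V' 4 p) (V' 2 p); have [_ + _] := str' U'p (V' 4 p) (V' 2 p).
have [_ ->] := dtau_invariant (V' 4 p) (V' 2 p).
rewrite /wedge /coframe !gram' => -> .
have -> : g (V' 4 p) (V 2 p) = d by rewrite E2' (gZr gP) gram' mulr1.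
have -> : g (V' 2 p) (V 1 p) = 0 by rewrite E2 (gZl gP) gram mulr0.
have -> : g (V' 2 p) (V 2 p) = 0 by rewrite E2 (gZl gP) gram mulr0.
have -> : g (V' 2 p) (V 4 p) = d by rewrite E2 (gZl gP) gram mulr1.
rewrite d1 => H; lra.
Qed.

End FrameChange.

Theorem proposition8 (R : realType) (M : manifold R 5)
    (phi : endo_field M) (xi : vfield M) (eta : oneform M)
    (g : bilinear_field M) (nabla : vfield M -> vfield M -> vfield M)
    (sigma : R) (U : set M) (V : 'I_5 -> vfield M)
    (tau1 tau2 omega : oneform M) :
  almost_paracontact_metric (n := 2) phi xi eta g ->
  levi_civita g nabla ->
  weakly_paracosymplectic phi eta g nabla ->
  parakahler_leaves phi eta g ->
  sigma = 1 \/ sigma = -1 ->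
  elliptic_or_hyperbolic phi xi g nabla sigma ->
  adopted_frame phi xi g nabla sigma U V ->
  connection_forms g nabla U V tau1 tau2 omega ->
  exists alpha1 alpha2 beta1 beta2 gamma : M -> R,
    [/\ smooth_on U alpha1, smooth_on U alpha2, smooth_on U beta1,
        smooth_on U beta2 & smooth_on U gamma] /\
    structure_equations g U V tau1 tau2 omega
      alpha1 alpha2 beta1 beta2 gamma /\
    curvature_decomposition g nabla sigma U V
      alpha1 alpha2 beta1 beta2 gamma /\
    ricci_decomposition g nabla U V alpha1 alpha2 beta1 beta2 /\
    (forall p, U p ->
       scalar_curvature g nabla p = - 2 * (alpha2 p + beta2 p)) /\
    ricci_eigenfunctions g nabla U alpha2 beta2 /\
    (forall (U' : set M) (V' : 'I_5 -> vfield M)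
       (tau1' tau2' omega' : oneform M)
       (alpha1' alpha2' beta1' beta2' gamma' : M -> R),
       adopted_frame phi xi g nabla sigma U' V' ->
       connection_forms g nabla U' V' tau1' tau2' omega' ->
       structure_equations g U' V' tau1' tau2' omega'
         alpha1' alpha2' beta1' beta2' gamma' ->
       forall p, U p -> U' p -> alpha2' p = alpha2 p /\ beta2' p = beta2 p).
Proof.
move=> apc lc [_ phi_comm] _ sigma1 _ adopted conn.
have sigma0 : sigma != 0.
  by case: sigma1 => ->; rewrite ?oppr_eq0 oner_eq0.
pose C i j k l := frame_curvature g nabla V i j k l.
have sC i j k l : smooth_on U (C i j k l).
  exact: (frame_curvature_smooth apc lc adopted).
have oU := frame_open adopted.
exists (C 3 4 1 3), (C 3 1 1 3), (C 3 4 2 4), (C 4 2 2 4), (fun p => C 3 4 3 4 p - sigma).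
split; first by split=> //; apply: smooth_on_sub_fun => //; exact: smooth_on_cst.
have str : structure_equations g U V tau1 tau2 omega
    (C 3 4 1 3) (C 3 1 1 3) (C 3 4 2 4) (C 4 2 2 4) (fun p => C 3 4 3 4 p - sigma).
  move=> p Up x y; split.
  - exact: (dtau1E apc lc adopted conn phi_comm Up).
  - exact: (dtau2E apc lc adopted conn phi_comm Up).
  - exact: (DomegaE apc lc adopted conn phi_comm Up).
split=> //; split.
  move=> p Up x y z w; rewrite (riemann4E apc lc adopted conn phi_comm Up).
  by rewrite addrCA subrr addr0.
split.
  move=> p Up x y; split; first exact: (ricci_trace_g _ apc).
  exact: (ricciE apc lc adopted conn phi_comm Up).
split.
  by move=> p Up; exact: (scalar_curvatureE apc lc adopted conn phi_comm Up).
split.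
  by move=> p Up; exact: (ricci_char_poly apc lc adopted conn phi_comm Up).
move=> U' V' tau1' tau2' omega' a1 a2 b1 b2 c adopted' conn' str' p Up U'p.
exact: (structure_invariant apc lc sigma0 adopted adopted' conn conn' Up U'p str str').
Qed.
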